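(* Let $d\ge3$, $N\ge1$, and let $t\mapsto(U_t,V_t)=(U_{t,(n)},V_{t,(n)})_{1\le n\le N}\in(\mathbb{R}^d\times\mathbb{R}^d)^N$ be a spherically coupled Nanbu particle system with Maxwell collisions with angular kernel $b$. Then: (i) its dynamics is invariant (in law) under isometries of $\mathbb{R}^d$ applied simultaneously to each of the $2\times N$ velocities; (ii) the coupling is almost surely decreasing: for all $0\le t\le t+h$, $$\frac1N\sum_{n=1}^N|U_{t+h,(n)}-V_{t+h,(n)}|^2\le\frac1N\sum_{n=1}^N|U_{t,(n)}-V_{t,(n)}|^2\quad\text{a.s.}$$
   Context: $b$ is a positive measure on $[0,\pi]$; Grad's cut-off is in force, i.e. $b$ has finite total mass. Isotropic transition: for $\theta\in[0,\pi]$, $n\in\mathbb{S}^{d-1}$, $c_\theta(n,\cdot)$ is the uniform probability on $\{n'\in\mathbb{S}^{d-1}:n\cdot n'=\cos\theta\}$. Spherical coupling: for $n_u,n_v\in\mathbb{S}^{d-1}$ with $n_u\ne-n_v$, $\mathrm{Coupl}_{n_u,n_v}$ is the rotation of $\mathbb{R}^d$ that fixes $\mathrm{Span}(n_u,n_v)^\perp$ and acts on the plane $\mathrm{Span}(n_u,n_v)$ as the rotation bringing $n_u$ to $n_v$ (the identity if $n_u=n_v$). The coupled transition $c_{c,\theta}(n_u,n_v,\mathrm{d}n'_u\mathrm{d}n'_v)$ is the law of $(n'_u,n'_v)$ where $n'_u\sim c_\theta(n_u,\cdot)$ and $n'_v=\mathrm{Coupl}_{n_u,n_v}(n'_u)$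 if $n_u\neq-n_v$; if $n_u=-n_v$, $n'_v=R_\sigma n'_u$, where $\sigma$ is uniform on $\mathbb{S}^{d-1}$, independent of $n'_u$, and $R_\sigma$ is the half-turn equal to $-\mathrm{Id}$ on $\mathrm{Span}(n_u,\sigma)$ and to $\mathrm{Id}$ on its orthogonal complement. Coupled collisions: for $(u,v,u_\ast,v_\ast)\in(\mathbb{R}^d\times\mathbb{R}^d)^2$, put $n_u=\frac{u-u_\ast}{|u-u_\ast|}$, $n_v=\frac{v-v_\ast}{|v-v_\ast|}$ (arbitrary unit vectors when undefined), and given $(n'_u,n'_v)$: $u'=\frac12(u+u_\ast)+\frac12|u-u_\ast|n'_u$, $u'_\ast=\frac12(u+u_\ast)-\frac12|u-u_\ast|n'_u$, and similarly $v',v'_\ast$ from $v,v_\ast,n'_v$. The two-body coupled generator is $$L_c\psi(u,v,u_\ast,v_\ast)=\int\big(\psi(u',v',u'_\ast,v'_\ast)-\psi(u,v,u_\ast,v_\ast)\big)\,c_{c,\theta}(n_u,n_v,\mathrm{d}n'_u\mathrm{d}n'_v)\,b(\mathrm{d}\theta).$$ The spherically coupled Nanbu particle system is the Markov jump process on $(\mathbb{R}^d\times\mathbb{R}^d)^N$ with generator $\frac1N\sum_{n,m=1}^NL_c^{(n,m)}$, where $L_c^{(n,m)}$ is $L_c$ acting on the particles $n$ and $m$. Invariance in law under an isometry $g$ of $\mathbb{R}^d$ means that the image under $g$ (acting on every velocity) of the process started from $x$ has the law of the process started from $gx$. *)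

(* Defs.v *)
From HB Require Import structures.
From mathcomp Require Import all_boot all_order all_algebra.
From mathcomp Require Import all_classical all_reals all_analysis.
From mathcomp Require Import ring lra.

Set Implicit Arguments.
Unset Strict Implicit.
Unset Printing Implicit Defensive.

Import Order.TTheory GRing.Theory Num.Theory numFieldNormedType.Exports.

Local Open Scope classical_set_scope.
Local Open Scope ring_scope.

(* ['rV[R]_d] is given the product (= Borel) sigma-algebra, generated by the
   coordinates. *)
Definition measure_row_display : measure_display -> measure_display.
Proof. exact. Qed.

Section measurable_row.
Context {disp : measure_display} {T : sigmaRingType disp}.
Variable n : nat.

Let coors : 'I_n -> 'rV[T]_n -> T := fun i x => x ord0 i.

Let row_set0 : g_sigma_preimage coors set0.
Proof. exact: sigma_algebra0. Qed.

Let row_setC A : g_sigma_preimage coors A -> g_sigma_preimage coors (~` A).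
Proof. exact: sigma_algebraC. Qed.

Let row_bigcup (F : (set 'rV[T]_n)^nat) :
  (forall i, g_sigma_preimage coors (F i)) ->
  g_sigma_preimage coors (\bigcup_i (F i)).
Proof. exact: sigma_algebra_bigcup. Qed.

HB.instance Definition _ := @isMeasurable.Build (measure_row_display disp)
  'rV[T]_n (g_sigma_preimage coors) row_set0 row_setC row_bigcup.

End measurable_row.

Section euclidean.
Context {R : realType} {d : nat}.
Local Notation E := 'rV[R]_d.

Definition dot (x y : E) : R := \sum_(i < d) x ord0 i * y ord0 i.

(* The library norm on ['rV[R]_d] is the sup norm, hence this definition. *)
Definition enorm (x : E) : R := Num.sqrt (dot x x).

Definition euclid_isometry (g : E -> E) : Prop :=
  forall x y, enorm (g x - g y) = enorm (x - y).

Definition sphere : set E := [set n | enorm n = 1].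

Definition sphere_slice (n : E) (theta : R) : set E :=
  [set n' | sphere n' /\ dot n n' = cos theta].

(* When [S] is a Euclidean sphere of some dimension (the only use below), the
   isometries preserving [S] act transitively on it and this characterises a
   unique measure: the uniform probability on [S]. *)
Definition uniform_on (S : set E) (mu : set E -> \bar R) : Prop :=
  mu S = 1%E /\
  forall g : E -> E, euclid_isometry g -> g @^-1` S = S ->
    forall A, measurable A -> mu (g @^-1` A) = mu A.

(* Reflection across the hyperplane orthogonal to [y]; identity if [y = 0]. *)
Definition reflect_orth (y x : E) : E := x - (2 * dot x y / dot y y) *: y.

(* The rotation of the plane Span(a, b) by the angle from [a] to [b], as a
   product of two reflections: [a] goes to [- a], then to [b]. *)
Definition sph_coupl (a b x : E) : E := reflect_orth (a + b) (reflect_orth a x).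

(* - Id on Span(a, s) and Id on its orthogonal complement: product of the
   reflections along two orthogonal vectors spanning Span(a, s). *)
Definition half_turn (a s x : E) : E :=
  reflect_orth (s - (dot s a / dot a a) *: a) (reflect_orth a x).

End euclidean.

Section euclidean_theory.
Context {R : realType} {d : nat}.
Local Notation E := 'rV[R]_d.
Implicit Types (a b s x y z : E) (k : R).

Lemma dotC x y : dot x y = dot y x.
Proof. by apply: eq_bigr => i _; rewrite mulrC. Qed.

Lemma dotDl x y z : dot (x + y) z = dot x z + dot y z.
Proof. by rewrite -big_split; apply: eq_bigr => i _; rewrite !mxE mulrDl. Qed.

Lemma dotZl k x y : dot (k *: x) y = k * dot x y.
Proof. by rewrite mulr_sumr; apply: eq_bigr => i _; rewrite !mxE mulrA. Qed.

Lemma dotNl x y : dot (- x) y = - dot x y.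
Proof. by rewrite -scaleN1r dotZl mulN1r. Qed.

Lemma dotDr x y z : dot x (y + z) = dot x y + dot x z.
Proof. by rewrite dotC dotDl !(dotC x). Qed.

Lemma dotZr k x y : dot x (k *: y) = k * dot x y.
Proof. by rewrite dotC dotZl dotC. Qed.

Lemma dotNr x y : dot x (- y) = - dot x y.
Proof. by rewrite dotC dotNl dotC. Qed.

Definition dotE := (dotDl, dotDr, dotNl, dotNr, dotZl, dotZr).

Lemma dotxx_ge0 x : 0 <= dot x x.
Proof. by apply: sumr_ge0 => i _; rewrite -expr2 sqr_ge0. Qed.

Lemma dotxx_eq0 x : (dot x x == 0) = (x == 0).
Proof.
apply/idP/eqP => [|->]; last by rewrite /dot big1// => i _; rewrite mxE mul0r.
rewrite psumr_eq0 => [/allP x0|i _]; last by rewrite -expr2 sqr_ge0.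
apply/rowP => i; rewrite mxE; apply/eqP.
by have := x0 i (mem_index_enum i); rewrite -expr2 sqrf_eq0.
Qed.

Lemma sphere_dot x : sphere x <-> dot x x = 1.
Proof.
rewrite /sphere /= /enorm; split => [x1|->]; last by rewrite sqrtr1.
by rewrite -(sqr_sqrtr (dotxx_ge0 x)) x1 expr1n.
Qed.

Lemma reflect_dot y x z : dot (reflect_orth y x) (reflect_orth y z) = dot x z.
Proof.
rewrite /reflect_orth; have [->|y0] := eqVneq y 0.
  by rewrite !scaler0 !subr0.
rewrite !dotE (dotC y z); have : dot y y != 0 by rewrite dotxx_eq0.
move: (dot y y) (dot x y) (dot z y) (dot x z) => p q r t p0; by field.
Qed.

Lemma reflect_linear y : linear (reflect_orth y).
Proof.
move=> k x z; rewrite /reflect_orth !dotE.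
by apply/rowP => i; rewrite !mxE; ring.
Qed.

Lemma reflect_fix y x : dot x y = 0 -> reflect_orth y x = x.
Proof. by move=> xy0; rewrite /reflect_orth xy0 mulr0 mul0r scale0r subr0. Qed.

Lemma reflect_self y : reflect_orth y y = - y.
Proof.
rewrite /reflect_orth; have [->|y0] := eqVneq y 0.
  by rewrite scaler0 subr0 oppr0.
rewrite mulfK ?dotxx_eq0//; apply/rowP => i; rewrite !mxE; ring.
Qed.

Lemma sph_coupl_dot a b x y : dot (sph_coupl a b x) (sph_coupl a b y) = dot x y.
Proof. by rewrite !reflect_dot. Qed.

Lemma sph_coupl_linear a b : linear (sph_coupl a b).
Proof. by move=> k x y; rewrite /sph_coupl !reflect_linear. Qed.

Lemma sph_coupl_fix a b x : dot x a = 0 -> dot x b = 0 -> sph_coupl a b x = x.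
Proof.
by move=> xa xb; rewrite /sph_coupl !reflect_fix// dotDr xa xb addr0.
Qed.

Lemma dot_addxx_neq0 a b : a != - b -> dot (a + b) (a + b) != 0.
Proof. by rewrite dotxx_eq0 addr_eq0. Qed.

Lemma sph_coupl_src a b :
  sphere a -> sphere b -> a != - b -> sph_coupl a b a = b.
Proof.
move=> /sphere_dot a1 /sphere_dot b1 /dot_addxx_neq0 ab0.
rewrite /sph_coupl reflect_self /reflect_orth.
suff -> : 2 * dot (- a) (a + b) / dot (a + b) (a + b) = - 1.
  by rewrite scaleN1r opprK addrA addNr add0r.
move: ab0; rewrite !dotE (dotC b a) a1 b1 => ab0.
by field.
Qed.

(* Of the two orthogonal maps of Span(a, b) sending [a] to [b], the rotation is
   the one for which this holds; the reflection sends [b] back to [a]. *)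
Lemma sph_coupl_tgt a b :
  sphere a -> sphere b -> a != - b ->
  sph_coupl a b b = (2 * dot a b) *: b - a.
Proof.
move=> /sphere_dot a1 /sphere_dot b1 /dot_addxx_neq0 ab0.
rewrite /sph_coupl {2}/reflect_orth (dotC b a) a1 divr1 /reflect_orth.
suff -> : 2 * dot (b - (2 * dot a b) *: a) (a + b) / dot (a + b) (a + b)
    = 1 - 2 * dot a b.
  by apply/rowP => i; rewrite !mxE; ring.
move: ab0; rewrite !dotE (dotC b a) a1 b1 => ab0.
by field.
Qed.

Lemma half_turn_dot a s x y : dot (half_turn a s x) (half_turn a s y) = dot x y.
Proof. by rewrite !reflect_dot. Qed.

Lemma half_turn_linear a s : linear (half_turn a s).
Proof. by move=> k x y; rewrite /half_turn !reflect_linear. Qed.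

Lemma half_turn_fix a s x : dot x a = 0 -> dot x s = 0 -> half_turn a s x = x.
Proof.
by move=> xa xs; rewrite /half_turn !reflect_fix// !dotE xa xs mulr0 subr0.
Qed.

Lemma half_turn_axis a s : dot (s - (dot s a / dot a a) *: a) a = 0.
Proof.
have [->|a0] := eqVneq a 0.
  by rewrite dotC /dot big1// => i _; rewrite mxE mul0r.
by rewrite !dotE divfK ?dotxx_eq0// subrr.
Qed.

Lemma half_turn_l a s : half_turn a s a = - a.
Proof.
by rewrite /half_turn reflect_self reflect_fix// dotNl dotC half_turn_axis oppr0.
Qed.

Lemma half_turn_r a s : half_turn a s s = - s.
Proof.
pose k := dot s a / dot a a; pose w := s - k *: a.
have wa : dot w a = 0 by exact: half_turn_axis.
have {2}-> : s = k *: a + w by rewrite /w addrC subrK.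
rewrite /half_turn -/k -/w reflect_linear reflect_self (reflect_fix wa).
rewrite reflect_linear reflect_self reflect_fix; last first.
  by rewrite dotNl dotC wa oppr0.
by rewrite scalerN -opprD /w addrC subrK.
Qed.

End euclidean_theory.

Section markov_jump_processes.
Context {R : realType} {dS : measure_display} {S : measurableType dS}.

Definition bounded_measurable (psi : S -> R) : Prop :=
  measurable_fun setT psi /\ exists M : R, forall x, `|psi x| <= M.

(* Families and processes are indexed by [R]; only times [t >= 0] matter. *)
Definition markov_semigroup (P : R -> R.-pker S ~> S) : Prop :=
  (forall x A, measurable A -> P 0 x A = \d_x A) /\
  (forall s t x A, 0 <= s -> 0 <= t -> measurable A ->
    P (s + t) x A = (\int[P s x]_y P t y A)%E).

(* [L psi] is the limit of [(P_h psi - psi) / h] as [h -> 0+], in sup norm, for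
   every bounded measurable [psi]. *)
Definition has_generator (P : R -> R.-pker S ~> S)
    (L : (S -> R) -> S -> R) : Prop :=
  forall psi, bounded_measurable psi -> forall e : R, 0 < e ->
    \forall h \near 0^'+, forall x,
      `|(\int[P h x]_y psi y - psi x) / h - L psi x| <= e.

Definition jump_path (f : R -> S) : Prop :=
  exists tau : nat -> R,
    [/\ tau 0 = 0, {homo tau : k l / (k <= l)%N >-> k <= l},
        tau k @[k --> \oo] --> +oo
      & forall k t, tau k <= t < tau k.+1 -> f t = f (tau k)].

Section process.
Context {dO : measure_display} {Omega : measurableType dO}.
Variables (Pr : probability Omega R) (X : R -> Omega -> S).

Definition past (s : R) : set (set Omega) :=
  <<s \bigcup_(r in `[0, s]) preimage_set_system setT (X r) measurable >>.

(* P(X_(s+t) \in B | F_s) = P_t(X_s, B), with F the natural filtration of X *)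
Definition markov_process (P : R -> R.-pker S ~> S) : Prop :=
  forall s t A B, 0 <= s -> 0 <= t -> past s A -> measurable B ->
    Pr (A `&` X (s + t) @^-1` B) = (\int[Pr]_(w in A) P t (X s w) B)%E.

Definition markov_jump_process (L : (S -> R) -> S -> R) : Prop :=
  [/\ forall t, 0 <= t -> measurable_fun setT (X t),
      {ae Pr, forall w, jump_path (X ^~ w)}
    & exists P : R -> R.-pker S ~> S,
        [/\ markov_semigroup P, has_generator P L & markov_process P]].

Definition started_from (x : S) : Prop := {ae Pr, forall w, X 0 w = x}.

End process.

(* Product sigma-algebra on paths, generated by the evaluations at [t >= 0]. *)
Definition path_measurable : set (set (R -> S)) :=
  <<s [set C | exists t A, [/\ 0 <= t, measurable A & C = [set f | A (f t)]]] >>.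

Definition same_law
    (d1 : measure_display) (O1 : measurableType d1) (P1 : probability O1 R)
    (X1 : R -> O1 -> S)
    (d2 : measure_display) (O2 : measurableType d2) (P2 : probability O2 R)
    (X2 : R -> O2 -> S) : Prop :=
  forall C, path_measurable C ->
    P1 [set w | C (X1 ^~ w)] = P2 [set w | C (X2 ^~ w)].

End markov_jump_processes.

Section nanbu.
Context {R : realType} {d : nat}.
Local Notation E := 'rV[R]_d.
(* ((u, v), (u_*, v_* )) *)
Local Notation two_body := ((E * E) * (E * E))%type.

Variables
  (* angular kernel: only its restriction to [0, pi] is used *)
  (b : {finite_measure set R -> \bar R})
  (* c (theta, n) = c_theta(n, .) *)
  (c : R.-pker (R * E)%type ~> E)
  (* uniform probability on the sphere *)
  (sigma : probability E R)
  (* values of n_u and n_v where these are undefined *)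
  (eu ev : E).

Definition isotropic_transition : Prop :=
  forall theta n, 0 <= theta <= pi -> sphere n ->
    uniform_on (sphere_slice n theta) (c (theta, n)).

Definition coupled_transition (theta : R) (nu nv : E) : set (E * E) -> \bar R :=
  if nu != - nv then
    pushforward (c (theta, nu)) (fun n' => (n', sph_coupl nu nv n'))
  else
    pushforward (c (theta, nu) \x sigma)%E
      (fun ns => (ns.1, half_turn nu ns.2 ns.1)).

Definition direction (e x : E) : E := if x == 0 then e else (enorm x)^-1 *: x.

Definition post_collision (u u' n' : E) : E * E :=
  (2^-1 *: (u + u') + (2^-1 * enorm (u - u')) *: n',
   2^-1 *: (u + u') - (2^-1 * enorm (u - u')) *: n').

Definition coupled_collision (z : two_body) (n' : E * E) : two_body :=
  let: ((u, v), (us, vs)) := z in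
  let: (u', us') := post_collision u us n'.1 in
  let: (v', vs') := post_collision v vs n'.2 in
  ((u', v'), (us', vs')).

Definition coupled_generator (psi : two_body -> R) (z : two_body) : R :=
  let: ((u, v), (us, vs)) := z in
  fine (\int[b]_(theta in `[0%R, pi])
    \int[coupled_transition theta (direction eu (u - us))
                                  (direction ev (v - vs))]_n'
      (psi (coupled_collision z n') - psi z)%:E)%E.

Variable N : nat.

Definition set_pair (x : N.-tuple (E * E)) (n m : 'I_N) (z : two_body) :
    N.-tuple (E * E) :=
  [tuple if i == n then z.1 else if i == m then z.2 else tnth x i | i < N].

(* For [n = m] a collision changes nothing ([u = u_*] gives [u' = u_*' = u]). *)
Definition nanbu_generator (psi : N.-tuple (E * E) -> R)
    (x : N.-tuple (E * E)) : R :=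
  N%:R^-1 * \sum_(n < N) \sum_(m < N)
    coupled_generator (fun z => psi (set_pair x n m z)) (tnth x n, tnth x m).

Definition coupled_nanbu_system (dO : measure_display)
    (Omega : measurableType dO) (Pr : probability Omega R)
    (X : R -> Omega -> N.-tuple (E * E)) : Prop :=
  markov_jump_process Pr X nanbu_generator.

Definition isometry_action (g : E -> E) (x : N.-tuple (E * E)) :
    N.-tuple (E * E) := map_tuple (fun uv => (g uv.1, g uv.2)) x.

Definition coupling_cost (x : N.-tuple (E * E)) : R :=
  N%:R^-1 * \sum_(n < N) enorm ((tnth x n).1 - (tnth x n).2) ^+ 2.

End nanbu.

(* Main.v *)
Require Import Defs.
From HB Require Import structures.
From mathcomp Require Import all_boot all_order all_algebra.
From mathcomp Require Import all_classical all_reals all_analysis.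
From mathcomp Require Import measurable_realfun ring lra.

Import Order.TTheory GRing.Theory Num.Theory numFieldNormedType.Exports.

Local Open Scope classical_set_scope.
Local Open Scope ring_scope.

Set Implicit Arguments.
Unset Strict Implicit.
Unset Printing Implicit Defensive.

(** Why the theorem is true.

    Everything about the process is read off its generator [L]. If a semigroup
    [P] has generator [L] in the uniform sense, then [P_h psi] equals
    [psi + h L psi] up to [h ^ 2] times the supremum of [L (L psi)]
    (lemma [transition_second_order]). Subdividing [0, t] gives two comparison
    principles: [L psi <= 0] implies [P_t psi <= psi] (lemma
    [transition_supermedian]), and two generators intertwined by a map [g] have
    intertwined semigroups (lemma [transition_intertwine]).

    Invariance under an isometry [g]. Once the Nanbu generator is known to
    commute with the action of [g], the semigroups are intertwined by this
    action, hence so are the finite-dimensional laws of the two processes, which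
    are iterated transition integrals, and a process is determined in law by its
    finite-dimensional laws (lemma [same_law_cylinder]). The commutation rests on
    the fact that the isotropic law around [f n] is the image by the linear
    isometry [f] of the isotropic law around [n] (lemma [isotropic_push]).
    As the uniform law is only given by its invariance, this needs its
    uniqueness: reflections make all balls of a given radius centred on the
    sphere equally probable, and two probabilities which are uniformly
    distributed in this sense coincide (lemma [uniformly_distributed_unique], by
    double counting of the pairs of close points). Given the auxiliary uniform
    point [s], both cases of the spherical coupling of [a] and [b] are a linear
    isometry sending [a] to [b] and depending equivariantly on [a], [b], [s]
    (definition [coupling_map]). The vectors [eu] and [ev], which replace the
    direction of a vanishing relative velocity, are not moved by [g]; but a pair
    with zero relative velocity ignores its direction, and the direction of the
    other pair has an isotropic law whatever the coupling (lemma
    [coupled_generator_isometry]).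

    Decrease of the coupling cost. A collision preserves total momenta and
    relative speeds, so that the post-collisional cost of a pair of particles is
    a decreasing affine function of the scalar product of the two new
    directions, and the pre-collisional cost is its value at the old directions.
    The rotation bringing [n_u] to [n_v] displaces no unit vector by a larger
    angle than [n_u] (lemma [sph_coupl_contract]), so that no collision increases
    the cost. Hence [L psi <= 0] for the indicator [psi] of each superlevel set of
    the cost, and no level is ever crossed upwards. Doing this for rational
    levels and times and using that paths are piecewise constant and
    right-continuous gives the statement at all times simultaneously (lemma
    [cost_decreasing]). *)

(** * Means of bounded functions and mixtures of probabilities *)

Section bounded_means.
Context {R : realType} {d} {S : measurableType d}.
Implicit Types (mu : {measure set S -> \bar R}) (f g : S -> R).

Lemma bounded_integrable mu f :
  (mu setT < +oo)%E -> bounded_measurable f -> mu.-integrable setT (EFin \o f).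
Proof.
move=> mufin [mf [M fM]]; apply: measurable_bounded_integrable => //.
exists M; split; first exact: num_real.
by move=> N MN x _; apply: le_trans (fM x) _; exact: ltW.
Qed.

Lemma bounded_measurable_cst (k : R) : bounded_measurable (fun _ : S => k).
Proof. by split; [exact: measurable_cst|exists `|k|]. Qed.

Lemma bounded_measurable_indic (A : set S) :
  measurable A -> bounded_measurable (\1_A : S -> R).
Proof.
move=> mA; split; first exact: measurable_indic.
by exists 1 => x; rewrite indicE; case: (x \in A); rewrite ?normr1 ?normr0.
Qed.

Lemma bounded_measurableD f g :
  bounded_measurable f -> bounded_measurable g ->
  bounded_measurable (fun x => f x + g x).
Proof.
move=> [mf [M fM]] [mg [K gK]]; split; first exact: measurable_funD.
by exists (M + K) => x; rewrite (le_trans (ler_normD _ _))// lerD.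
Qed.

Lemma bounded_measurableN f :
  bounded_measurable f -> bounded_measurable (fun x => - f x).
Proof.
move=> [mf [M fM]]; split; first exact: measurable_funN.
by exists M => x; rewrite normrN.
Qed.

Lemma bounded_measurableM f g :
  bounded_measurable f -> bounded_measurable g ->
  bounded_measurable (fun x => f x * g x).
Proof.
move=> [mf [M fM]] [mg [K gK]]; split; first exact: measurable_funM.
by exists (M * K) => x; rewrite normrM ler_pM.
Qed.

Lemma bounded_measurableB f g :
  bounded_measurable f -> bounded_measurable g ->
  bounded_measurable (fun x => f x - g x).
Proof. by move=> bf /bounded_measurableN; exact: bounded_measurableD. Qed.

Lemma bounded_measurableZ k f :
  bounded_measurable f -> bounded_measurable (fun x => k * f x).
Proof. exact/bounded_measurableM/bounded_measurable_cst. Qed.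

Lemma bounded_measurable_comp {d'} {S' : measurableType d'} (f : S -> R)
    (h : S' -> S) :
  bounded_measurable f -> measurable_fun setT h ->
  bounded_measurable (f \o h).
Proof.
move=> [mf [M fM]] mh; split; first exact: measurableT_comp.
by exists M => x /=.
Qed.

Section unit_mass.
Variable mu : {measure set S -> \bar R}.
Hypothesis mu1 : mu setT = 1%E.

Let mufin : (mu setT < +oo)%E. Proof. by rewrite mu1 ltry. Qed.

Lemma mean_cst (k : R) : \int[mu]_x k = k.
Proof. by rewrite Rintegral_cst// mu1 mulr1. Qed.

Lemma meanD f g : bounded_measurable f -> bounded_measurable g ->
  \int[mu]_x (f x + g x) = \int[mu]_x f x + \int[mu]_x g x.
Proof. by move=> bf bg; rewrite RintegralD//; exact: bounded_integrable. Qed.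

Lemma meanB f g : bounded_measurable f -> bounded_measurable g ->
  \int[mu]_x (f x - g x) = \int[mu]_x f x - \int[mu]_x g x.
Proof. by move=> bf bg; rewrite RintegralB//; exact: bounded_integrable. Qed.

Lemma meanZ k f : bounded_measurable f ->
  \int[mu]_x (k * f x) = k * \int[mu]_x f x.
Proof. by move=> bf; rewrite RintegralZl//; exact: bounded_integrable. Qed.

Lemma le_mean f g : bounded_measurable f -> bounded_measurable g ->
  (forall x, f x <= g x) -> \int[mu]_x f x <= \int[mu]_x g x.
Proof. by move=> bf bg fg; rewrite le_Rintegral//; exact: bounded_integrable. Qed.

Lemma mean_norm_le f M : bounded_measurable f ->
  (forall x, `|f x| <= M) -> `|\int[mu]_x f x| <= M.
Proof.
move=> bf fM; have fM' x : - M <= f x <= M by rewrite -ler_norml.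
rewrite ler_norml; apply/andP; split.
- rewrite -[X in X <= _](mean_cst (- M)); apply: le_mean => //.
  + exact: bounded_measurable_cst.
  + by move=> x; case/andP: (fM' x).
- rewrite -[X in _ <= X](mean_cst M); apply: le_mean => //.
  + exact: bounded_measurable_cst.
  + by move=> x; case/andP: (fM' x).
Qed.

End unit_mass.

End bounded_means.

Section mixtures.
Context {R : realType} {d1 d2} {T : measurableType d1} {S : measurableType d2}.
Variables (k : T -> {measure set S -> \bar R}).
Hypothesis mk : forall B, measurable B -> measurable_fun setT (fun t => k t B).

Section mixture.
Variables (mu : {measure set T -> \bar R}) (D : set T)
  (nu : {measure set S -> \bar R}).
Hypotheses (mD : measurable D)
  (nuE : forall B, measurable B -> nu B = (\int[mu]_(t in D) k t B)%E).

Section nonnegative.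
Import HBNNSimple.
Local Open Scope ereal_scope.

Let mixture_nnsfun (h : {nnsfun S >-> R}) :
  \int[nu]_y (h y)%:E = \int[mu]_(t in D) \int[k t]_y (h y)%:E.
Proof.
under [RHS]eq_integral do rewrite integralT_nnsfun sintegralE.
have mkr r : measurable_fun D (fun t => k t (h @^-1` [set r])).
  by apply: measurable_funTS; exact: mk.
rewrite ge0_integral_fsum//; last 2 first.
  by move=> r; apply: measurable_funeM; exact: mkr.
  by move=> r t _; exact: nnsfun_mulemu_ge0.
rewrite integralT_nnsfun sintegralE; apply: eq_fsbigr => r /[!inE] -[y _ <-].
by rewrite ge0_integralZl ?nuE// lee_fin.
Qed.

(** Simple functions reduce to sets, and monotone convergence does the rest. *)
Lemma ge0_integral_mixture (f : S -> \bar R) :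
  measurable_fun setT f -> (forall y, 0 <= f y) ->
  \int[nu]_y f y = \int[mu]_(t in D) \int[k t]_y f y.
Proof.
move=> mf f0; pose g := nnsfun_approx measurableT mf.
pose gE := fun n => EFin \o g n.
have mgE n : measurable_fun setT (gE n) by exact/measurable_EFinP.
have gE_ge0 n x : 0 <= gE n x by rewrite lee_fin.
have nd_gE x : {homo gE ^~ x : n m / (n <= m)%O >-> n <= m}.
  by move=> *; exact/lefP/nd_nnsfun_approx.
have gf (la : {measure set S -> \bar R}) :
    \int[la]_y f y = limn (fun n => \int[la]_y gE n y).
  rewrite -monotone_convergence//; apply: eq_integral => t _.
  by apply/esym/cvg_lim => //; exact: cvg_nnsfun_approx.
rewrite gf; under [RHS]eq_integral do rewrite gf.
rewrite monotone_convergence//; last 3 first.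
- move=> n; apply: measurable_funTS.
  by apply: measurable_fun_integral_kernel => //; exact: mk.
- by move=> n t _; exact: integral_ge0.
- by move=> t _ m n mn; apply: ge0_le_integral => // y _; exact: nd_gE.
by apply: congr_lim; apply/funext => n; exact: mixture_nnsfun.
Qed.

End nonnegative.
End mixture.

Hypothesis k1 : forall t, k t setT = 1%E.

(* A bounded [f] is shifted by its bound [M] to reduce to nonnegative
   functions, here and in the next lemma. *)
Lemma bounded_measurable_mean (f : S -> R) :
  bounded_measurable f -> bounded_measurable (fun t => \int[k t]_y f y).
Proof.
move=> bf; have [mf [M fM]] := bf; split; last first.
  by exists M => t; exact: mean_norm_le.
have -> : (fun t => \int[k t]_y f y) =
    (fun t => fine (\int[k t]_y (f y + M)%:E)%E - M).
  apply/funext => t; rewrite -/(Rintegral _ _ _) meanD ?mean_cst ?addrK//.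
  exact: bounded_measurable_cst.
apply: measurable_funB; last exact: measurable_cst.
apply: measurableT_comp; first exact: fine_measurable.
apply: measurable_fun_integral_kernel => //.
- by move=> y; rewrite lee_fin -lerBlDr sub0r; move: (fM y); rewrite ler_norml => /andP[].
- by apply/measurable_EFinP/measurable_funD.
Qed.

(** Integration against a mixture [nu] of probabilities [k t]: the two uses are
    the Chapman-Kolmogorov equation and the Markov property, which are stated
    for sets and needed for functions. *)
Lemma mean_mixture (mu : {measure set T -> \bar R}) (D : set T)
    (nu : {measure set S -> \bar R}) (f : S -> R) :
  measurable D -> (mu D < +oo)%E ->
  (forall B, measurable B -> nu B = (\int[mu]_(t in D) k t B)%E) ->
  bounded_measurable f ->
  \int[nu]_y f y = \int[mu]_(t in D) \int[k t]_y f y.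
Proof.
move=> mD muD nuE bf; have [mf [M fM]] := bf.
have fM0 y : 0 <= f y + M.
  by rewrite -lerBlDr sub0r; move: (fM y); rewrite ler_norml => /andP[].
have bfM : bounded_measurable (fun y => f y + M).
  exact/bounded_measurableD/bounded_measurable_cst.
have nuT : nu setT = mu D.
  rewrite nuE//; under eq_integral do rewrite k1.
  by rewrite integral_cst// mul1e.
have nufin : (nu setT < +oo)%E by rewrite nuT.
have iE (la : {measure set S -> \bar R}) g : bounded_measurable g ->
    (la setT < +oo)%E -> (\int[la]_y (g y)%:E = (\int[la]_y g y)%:E)%E.
  move=> bg lafin; rewrite /Rintegral fineK//.
  by apply: integrable_fin_num => //; exact: bounded_integrable.
have bD g : bounded_measurable g -> mu.-integrable D (EFin \o g).
  move=> [mg [K gK]]; apply: measurable_bounded_integrable => //.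
    exact: measurable_funTS.
  exists K; split; first exact: num_real.
  by move=> N KN x _; apply: le_trans (gK x) _; exact: ltW.
have : \int[nu]_y (f y + M) = \int[mu]_(t in D) (\int[k t]_y f y + M).
  rewrite /Rintegral (ge0_integral_mixture mD nuE); last 2 first.
  - exact/measurable_EFinP/bfM.1.
  - by move=> y; rewrite lee_fin.
  congr fine; apply: eq_integral => t _.
  rewrite iE ?k1 ?ltry// meanD// ?mean_cst//.
  exact: bounded_measurable_cst.
rewrite RintegralD//; last 2 first.
- exact: bounded_integrable.
- exact/bounded_integrable/bounded_measurable_cst.
rewrite RintegralD//; last 2 first.
- exact/bD/bounded_measurable_mean.
- exact/bD/bounded_measurable_cst.
by rewrite !Rintegral_cst// nuT => /addIr.
Qed.

End mixtures.

(** * Markov semigroups and their generators *)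

Section small_increments.
Context {R : realType}.

(** Cutting [0, t] into [n] equal pieces, the increment of [F] over [0, t] is at
    most [n (t / n) (K + e)]: a mean value inequality for functions whose small
    increments are controlled uniformly in the base point. *)
Lemma small_increments_le (F : R -> R) (t K : R) : 0 <= t ->
  (forall e, 0 < e -> exists2 dl : R, 0 < dl & forall s h, 0 <= s ->
     0 < h < dl -> s + h <= t -> F (s + h) - F s <= h * (K + e)) ->
  F t - F 0 <= t * K.
Proof.
rewrite le_eqVlt => /predU1P[<- _|t0 H]; first by rewrite subrr mul0r.
apply/ler_addgt0Pr => e e0.
have [dl dl0 /= Hdl] := H _ (divr_gt0 e0 t0).
pose n := Num.bound (t / dl).
have tn : t / dl < n%:R by apply: archi_boundP; rewrite ltW// divr_gt0.
have n0 : 0 < n%:R :> R by rewrite (lt_trans _ tn)// divr_gt0.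
pose h := t / n%:R.
have h0 : 0 < h by rewrite divr_gt0.
have hdl : h < dl.
  by rewrite ltr_pdivrMr// mulrC -ltr_pdivrMr.
have nh : n%:R * h = t by rewrite mulrC divfK// gt_eqF.
suff Hk k : (k <= n)%N -> F (k%:R * h) - F 0 <= k%:R * h * (K + e / t).
  have := Hk n (leqnn n); rewrite nh mulrDr => /le_trans; apply.
  by rewrite lerD2l mulrC divfK// gt_eqF.
elim: k => [_|k IH kn]; first by rewrite !mul0r subrr.
have kh : k.+1%:R * h = k%:R * h + h by rewrite -natr1 mulrDl mul1r.
rewrite kh mulrDl.
have -> : F (k%:R * h + h) - F 0 =
    (F (k%:R * h) - F 0) + (F (k%:R * h + h) - F (k%:R * h)) by ring.
apply: lerD; first exact/IH/ltnW.
apply: Hdl; first by rewrite mulr_ge0// ltW.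
  by rewrite h0.
by rewrite -kh -nh ler_wpM2r ?ler_nat// ltW.
Qed.

Lemma small_increments_norm (F : R -> R) (t K : R) : 0 <= t ->
  (forall e, 0 < e -> exists2 dl : R, 0 < dl & forall s h, 0 <= s ->
     0 < h < dl -> s + h <= t -> `|F (s + h) - F s| <= h * (K + e)) ->
  `|F t - F 0| <= t * K.
Proof.
move=> t0 H; rewrite ler_norml; apply/andP; split; last first.
  apply: small_increments_le => // e /H[dl dl0 {}H]; exists dl => // s h s0 h0 st.
  exact: le_trans (ler_norm _) (H _ _ s0 h0 st).
rewrite lerNl opprB.
have -> : F 0 - F t = (- F t) - (- F 0) by ring.
apply: (small_increments_le (F := fun s => - F s)) => // e /H[dl dl0 {}H].
exists dl => // s h s0 h0 st; apply: le_trans (H _ _ s0 h0 st).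
have -> : - F (s + h) - - F s = - (F (s + h) - F s) by ring.
by rewrite -normrN ler_norm.
Qed.

End small_increments.

Section semigroups.
Context {R : realType} {d} {S : measurableType d}.

Definition transition (P : R -> R.-pker S ~> S) (t : R) (psi : S -> R) (x : S) :=
  \int[P t x]_y psi y.

Section transition_theory.
Variables (P : R -> R.-pker S ~> S).
Implicit Types (phi psi : S -> R).

Lemma transition_bounded t psi :
  bounded_measurable psi -> bounded_measurable (transition P t psi).
Proof.
apply: bounded_measurable_mean.
- by move=> B mB; exact: measurable_kernel.
- by move=> ?; exact: prob_kernel.
Qed.

Lemma transition_norm_le t psi M x : bounded_measurable psi ->
  (forall y, `|psi y| <= M) -> `|transition P t psi x| <= M.
Proof. by apply: mean_norm_le; exact: prob_kernel. Qed.

Lemma transition_le t phi psi x :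
  bounded_measurable phi -> bounded_measurable psi ->
  (forall y, phi y <= psi y) -> transition P t phi x <= transition P t psi x.
Proof. by apply: le_mean; exact: prob_kernel. Qed.

Lemma transitionB t phi psi x :
  bounded_measurable phi -> bounded_measurable psi ->
  transition P t (fun y => phi y - psi y) x =
  transition P t phi x - transition P t psi x.
Proof. by apply: meanB; exact: prob_kernel. Qed.

Lemma transitionZ t k psi x : bounded_measurable psi ->
  transition P t (fun y => k * psi y) x = k * transition P t psi x.
Proof. by apply: meanZ; exact: prob_kernel. Qed.

Hypothesis semiP : markov_semigroup P.

Lemma transition0 psi : bounded_measurable psi -> transition P 0 psi = psi.
Proof.
move=> bpsi; apply/funext => x; rewrite /transition /Rintegral.
rewrite (eq_measure_integral (dirac x)) => [|A mA _]; last exact: semiP.1.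
rewrite integral_dirac ?diracT ?mul1e//.
exact/measurable_EFinP/bpsi.1.
Qed.

Lemma transitionD s t psi x : 0 <= s -> 0 <= t -> bounded_measurable psi ->
  transition P (s + t) psi x = transition P s (transition P t psi) x.
Proof.
move=> s0 t0 bpsi; apply: mean_mixture => //.
- by move=> B mB; exact: measurable_kernel.
- by move=> ?; exact: prob_kernel.
- by rewrite prob_kernel ltry.
- by move=> B mB; exact: semiP.2.
Qed.

End transition_theory.

Section generator.
Variables (P : R -> R.-pker S ~> S) (L : (S -> R) -> S -> R).
Hypotheses (semiP : markov_semigroup P) (genP : has_generator P L).
Implicit Types (phi psi : S -> R).

Lemma generator_expansion psi e : bounded_measurable psi -> 0 < e ->
  exists2 dl : R, 0 < dl & forall h x, 0 < h < dl ->
    `|transition P h psi x - psi x - h * L psi x| <= h * e.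
Proof.
move=> bpsi e0; have [dl /= dl0 H] := genP bpsi e0.
exists dl => // h x /andP[h0 hdl].
have hb : ball_ [eta Num.Def.normr] 0 dl h by rewrite /ball_/= sub0r normrN gtr0_norm.
have {}H := H h hb h0 x.
have -> : transition P h psi x - psi x - h * L psi x =
    h * ((transition P h psi x - psi x) / h - L psi x).
  by rewrite mulrBr mulrCA divff ?mulr1// gt_eqF.
by rewrite normrM gtr0_norm// ler_pM2l.
Qed.

(** [L psi] inherits measurability as a pointwise limit of difference quotients
    and boundedness from a single quotient at uniform distance from it. *)
Lemma generator_bounded psi : bounded_measurable psi ->
  bounded_measurable (L psi).
Proof.
move=> bpsi; split.
  pose u (n : nat) x := n.+1%:R * (transition P n.+1%:R^-1 psi x - psi x).
  apply: (measurable_fun_cvg (h := u)) => [n|x _].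
    apply: (bounded_measurableZ _ _).1.
    exact/bounded_measurableB/bpsi/transition_bounded.
  apply/cvgrPdist_le => e e0; have [dl dl0 H] := generator_expansion bpsi e0.
  near=> n; rewrite /u distrC.
  have n0 : 0 < n.+1%:R :> R by rewrite ltr0n.
  have := H n.+1%:R^-1 x; rewrite invr_gt0 n0/=.
  have -> : n.+1%:R^-1 < dl.
    by near: n; exact: near_infty_natSinv_lt (PosNum dl0).
  move=> /(_ isT); rewrite -(ler_pM2l n0) mulrA mulfV ?gt_eqF// mul1r.
  apply: le_trans; rewrite -[X in _ <= X * _](gtr0_norm n0) -normrM.
  by rewrite (mulrBr _ (_ - _)) mulrA mulfV ?gt_eqF// mul1r.
have [dl dl0 H] := generator_expansion bpsi ltr01.
have [_ [M psiM]] := bpsi.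
have h0 : 0 < dl / 2 by rewrite divr_gt0.
exists ((dl / 2 + (M + M)) / (dl / 2)) => x.
rewrite ler_pdivlMr//; have -> : `|L psi x| * (dl / 2) = `|dl / 2 * L psi x|.
  by rewrite normrM (gtr0_norm h0) mulrC.
have hdl : 0 < dl / 2 < dl by rewrite h0/= ltr_pdivrMr// mulr_natr mulr2n ltrDl.
have {H}/= := H (dl / 2) x hdl; rewrite mulr1 => H.
have -> : dl / 2 * L psi x =
    - (transition P (dl / 2) psi x - psi x - dl / 2 * L psi x) +
    (transition P (dl / 2) psi x - psi x) by ring.
rewrite (le_trans (ler_normD _ _))// normrN lerD// (le_trans (ler_normB _ _))//.
by rewrite lerD// transition_norm_le.
Unshelve. all: by end_near. Qed.

Let increment s h psi x : 0 <= s -> 0 <= h -> bounded_measurable psi ->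
  transition P (s + h) psi x - transition P s psi x =
  transition P s (fun y => transition P h psi y - psi y) x.
Proof.
move=> s0 h0 bpsi; rewrite transitionD// transitionB//.
exact: transition_bounded.
Qed.

(** The first-order bound and the second-order one below are mean value
    inequalities along [s |-> P_s psi x]. The point of the second is that the
    constant depends on [psi] only through [L (L psi)]: no uniform bound of the
    operator [L] is involved. *)
Lemma transition_first_order t psi M x : 0 <= t -> bounded_measurable psi ->
  (forall y, `|L psi y| <= M) -> `|transition P t psi x - psi x| <= t * M.
Proof.
move=> t0 bpsi LM; rewrite -[in X in _ - X](transition0 semiP bpsi).
apply: (small_increments_norm (F := fun s => transition P s psi x)) => // e e0.
have [dl dl0 H] := generator_expansion bpsi e0; exists dl => // s h s0 hdl _.
have /andP[h0 _] := hdl; rewrite increment// ?(ltW h0)//.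
apply: transition_norm_le.
  by apply: bounded_measurableB => //; exact: transition_bounded.
move=> y; rewrite mulrDr.
rewrite -[X in `|X|](subrK (h * L psi y)) (le_trans (ler_normD _ _))//.
rewrite [X in _ <= X]addrC.
by rewrite lerD// ?H// normrM gtr0_norm// ler_pM2l.
Qed.

Lemma transition_second_order t psi M x : 0 <= t -> bounded_measurable psi ->
  (forall y, `|L (L psi) y| <= M) ->
  `|transition P t psi x - psi x - t * L psi x| <= t ^+ 2 * M.
Proof.
move=> t0 bpsi LLM; have bL := generator_bounded bpsi.
have bP h := transition_bounded P h bpsi.
pose F s := transition P s psi x - s * L psi x.
have -> : transition P t psi x - psi x - t * L psi x = F t - F 0.
  by rewrite /F transition0// mul0r subr0 addrAC.
rewrite expr2 -mulrA; apply: small_increments_norm => // e e0.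
have [dl dl0 H] := generator_expansion bpsi e0; exists dl => // s h s0 hdl st.
have /andP[h0 _] := hdl.
have bD : bounded_measurable (fun y => transition P h psi y - psi y).
  exact: bounded_measurableB.
have bhL : bounded_measurable (fun y => h * L psi y).
  exact: bounded_measurableZ.
have -> : F (s + h) - F s =
    transition P s (fun y => transition P h psi y - psi y - h * L psi y) x +
    h * (transition P s (L psi) x - L psi x).
  rewrite transitionB// transitionZ// -increment ?(ltW h0)// /F; ring.
rewrite (le_trans (ler_normD _ _))// (mulrDr h (t * M)) [X in _ <= X]addrC.
rewrite lerD//; last first.
- rewrite normrM gtr0_norm// ler_pM2l// (le_trans (transition_first_order _ s0 bL LLM))//.
  rewrite ler_wpM2r//; first exact: le_trans (normr_ge0 _) (LLM x).
  by rewrite (le_trans _ st)// lerDl ltW.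
- apply: transition_norm_le; first exact: bounded_measurableB.
  by move=> y; exact: H.
Qed.

(** The generator commutes with its semigroup: both sides are limits of
    [(P_(r + h) psi - P_r psi) / h], since [P_r] contracts the uniform norm. *)
Lemma generator_transition r psi x : 0 <= r -> bounded_measurable psi ->
  L (transition P r psi) x = transition P r (L psi) x.
Proof.
move=> r0 bpsi; have bP h := transition_bounded P h bpsi.
have bL := generator_bounded bpsi.
apply/eqP; rewrite -subr_eq0 -normr_le0; apply/ler_addgt0Pr => e e0.
rewrite add0r; have e20 : 0 < e / 2 by rewrite divr_gt0.
have [d1 d10 H1] := generator_expansion bpsi e20.
have [d2 d20 H2] := generator_expansion (bP r) e20.
pose h := Num.min d1 d2 / 2.
have m0 : 0 < Num.min d1 d2 by rewrite lt_min d10.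
have h0 : 0 < h by rewrite divr_gt0.
have hm : h < Num.min d1 d2 by rewrite ltr_pdivrMr// mulr_natr mulr2n ltrDl.
have h1 : 0 < h < d1 by rewrite h0 (lt_le_trans hm)// ge_min lexx.
have h2 : 0 < h < d2 by rewrite h0 (lt_le_trans hm)// ge_min lexx orbT.
have {}H2 := H2 h x h2.
rewrite -(ler_pM2l h0) -[in X in X <= _](gtr0_norm h0) -normrM.
have -> : h * (L (transition P r psi) x - transition P r (L psi) x) =
    - (transition P h (transition P r psi) x - transition P r psi x
       - h * L (transition P r psi) x) +
    transition P r (fun y => transition P h psi y - psi y - h * L psi y) x.
  rewrite transitionB//; last 2 first.
  - exact: bounded_measurableB.
  - exact: bounded_measurableZ.
  rewrite transitionB// transitionZ//.
  rewrite -(transitionD semiP) ?(ltW h0)// -(transitionD semiP) ?(ltW h0)// (addrC r h).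
  ring.
have -> : h * e = h * (e / 2) + h * (e / 2) by field.
rewrite (le_trans (ler_normD _ _))// normrN lerD//.
apply: transition_norm_le => [|y]; last exact: H1.
apply: bounded_measurableB; first exact: bounded_measurableB.
exact: bounded_measurableZ.
Qed.

(** [s |-> P_s psi x] has derivative [P_s (L psi) x <= 0]. *)
Lemma transition_supermedian t psi x : 0 <= t -> bounded_measurable psi ->
  (forall y, L psi y <= 0) -> transition P t psi x <= psi x.
Proof.
move=> t0 bpsi L0; rewrite -subr_le0 -[in X in _ - X](transition0 semiP bpsi).
rewrite -[X in _ <= X](mulr0 t).
apply: (small_increments_le (F := fun s => transition P s psi x)) => // e e0.
have [dl dl0 H] := generator_expansion bpsi e0; exists dl => // s h s0 hdl _.
have /andP[h0 _] := hdl; rewrite increment// ?(ltW h0)// add0r.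
rewrite -[X in _ <= X](mean_cst (mu := P s x)); last exact: prob_kernel.
apply: transition_le; last move=> y.
- by apply: bounded_measurableB => //; exact: transition_bounded.
- exact: bounded_measurable_cst.
have := le_trans (ler_norm _) (H h y hdl).
by rewrite lerBlDr => /le_trans; apply; rewrite gerDl pmulr_rle0.
Qed.

End generator.

End semigroups.

Section intertwining.
Context {R : realType} {d1 d2} {S1 : measurableType d1} {S2 : measurableType d2}.
Variables (P : R -> R.-pker S1 ~> S1) (L1 : (S1 -> R) -> S1 -> R).
Variables (Q : R -> R.-pker S2 ~> S2) (L2 : (S2 -> R) -> S2 -> R).
Hypotheses (semiP : markov_semigroup P) (genP : has_generator P L1).
Hypotheses (semiQ : markov_semigroup Q) (genQ : has_generator Q L2).
Variable g : S1 -> S2.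
Hypothesis mg : measurable_fun setT g.
Hypothesis L1gL2 : forall psi : S2 -> R, bounded_measurable psi ->
  L1 (psi \o g) = L2 psi \o g.

(** The path [s |-> P_s ((Q_(t-s) psi) \o g) x] joins the two sides. Its
    increments over a step [h] are [O(h^2)], uniformly: [P_h] and [Q_h] have the
    same expansion at order one, and the second-order remainders are governed
    by [L2 (L2 (Q_r psi)) = Q_r (L2 (L2 psi))], bounded independently of [r]. *)
Lemma transition_intertwine t psi x : 0 <= t -> bounded_measurable psi ->
  transition P t (psi \o g) x = transition Q t psi (g x).
Proof.
move=> t0 bpsi.
have bQ r := transition_bounded Q r bpsi.
have bQg r : bounded_measurable (transition Q r psi \o g).
  exact: bounded_measurable_comp.
have bL := generator_bounded genQ bpsi.
have [_ [M LLM]] := generator_bounded genQ bL.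
have LLQ r y : 0 <= r -> `|L2 (L2 (transition Q r psi)) y| <= M.
  move=> r0; have -> : L2 (transition Q r psi) = transition Q r (L2 psi).
    by apply/funext => z; exact: generator_transition.
  rewrite (generator_transition semiQ genQ)//; apply: transition_norm_le => //.
  exact: (generator_bounded genQ bL).
pose F s := transition P s (transition Q (t - s) psi \o g) x.
have -> : transition P t (psi \o g) x = F t by rewrite /F subrr transition0.
have -> : transition Q t psi (g x) = F 0.
  by rewrite /F subr0 transition0//; exact: bQg.
apply/eqP; rewrite -subr_eq0 -normr_le0 -[X in _ <= X](mulr0 t).
have M0 : 0 <= M by exact: le_trans (normr_ge0 _) (LLM (g x)).
apply: small_increments_norm => // e e0.
have M1 : 0 < M + M + 1 by rewrite ltr_wpDl// addr_ge0.
exists (e / (M + M + 1)); first by rewrite divr_gt0.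
move=> s h s0 /andP[h0 hdl] st; rewrite add0r.
pose r := t - (s + h); have r0 : 0 <= r by rewrite subr_ge0.
have h0' := ltW h0.
have -> : F s = transition P s (transition Q h (transition Q r psi) \o g) x.
  have -> : transition Q h (transition Q r psi) = transition Q (h + r) psi.
    by apply/funext => y; rewrite -(transitionD semiQ).
  by have -> : h + r = t - s by rewrite /r; ring.
have bhr : bounded_measurable (transition Q h (transition Q r psi) \o g).
  exact/bounded_measurable_comp/mg/transition_bounded.
rewrite /F -/r transitionD// -transitionB//; last exact: transition_bounded.
apply: transition_norm_le => [|y].
  by apply: bounded_measurableB => //; exact: transition_bounded.
have -> : transition P h (transition Q r psi \o g) y -
    (transition Q h (transition Q r psi) \o g) y =
  (transition P h (transition Q r psi \o g) y - (transition Q r psi \o g) y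
     - h * L1 (transition Q r psi \o g) y) -
  (transition Q h (transition Q r psi) (g y) - transition Q r psi (g y)
     - h * L2 (transition Q r psi) (g y)).
  by rewrite L1gL2//=; ring.
rewrite (le_trans (ler_normB _ _))//.
have A : h ^+ 2 * M + h ^+ 2 * M <= h * e.
  rewrite -mulrDr expr2 -mulrA ler_pM2l//.
  move: hdl; rewrite ltr_pdivlMr// => /ltW; apply: le_trans.
  by rewrite ler_pM2l// lerDl.
apply: le_trans A; apply: lerD.
- apply: (transition_second_order semiP genP) => // z.
  by rewrite L1gL2// L1gL2 ?LLQ//; exact: (generator_bounded genQ (bQ r)).
- apply: (transition_second_order semiQ genQ) => // z.
  exact: LLQ.
Qed.

End intertwining.

(** * Finite-dimensional laws of Markov processes *)

Section finite_dimensional_laws.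
Context {R : realType} {dS} {S : measurableType dS}.
Context {dO} {Omega : measurableType dO}.
Variables (Pr : probability Omega R) (X : R -> Omega -> S).
Hypothesis mX : forall t, 0 <= t -> measurable_fun setT (X t).

Lemma past_sub_measurable s A : past X s A -> measurable A.
Proof.
apply: smallest_sub; first exact: sigma_algebra_measurable.
apply: bigcup_sub => r /=; rewrite in_itv/= => /andP[r0 _] _ [B mB <-].
exact: mX.
Qed.

Lemma past_mono s t A : s <= t -> past X s A -> past X t A.
Proof.
move=> st; apply: sub_sigma_algebra2; apply: bigcup_sub => r /=.
rewrite in_itv/= => /andP[r0 rs] B XB; exists r => //.
by rewrite /= in_itv/= r0 (le_trans rs).
Qed.

Lemma past_preimage t B : 0 <= t -> measurable B -> past X t (X t @^-1` B).
Proof.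
move=> t0 mB; apply: sub_sigma_algebra; exists t; first by rewrite /= in_itv/= t0/=.
by exists B => //; rewrite setTI.
Qed.

Lemma past_setI t A B : past X t A -> past X t B -> past X t (A `&` B).
Proof.
by move=> pA pB; exact: (@measurableI _ (g_sigma_algebraType _)).
Qed.

Variable P : R -> R.-pker S ~> S.
Hypothesis XP : markov_process Pr X P.

(** The Markov property for functions: the law of [X (s + t)] restricted to [A] is
    a mixture in two ways, of the Dirac masses at [X (s + t) w] and of the
    transition probabilities from [X s w]. *)
Lemma markov_mean s t A phi : 0 <= s -> 0 <= t -> past X s A ->
  bounded_measurable phi ->
  \int[Pr]_(w in A) phi (X (s + t) w) = \int[Pr]_(w in A) transition P t phi (X s w).
Proof.
move=> s0 t0 pA bphi; have mA := past_sub_measurable pA.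
have mXst : measurable_fun setT (X (s + t)) by apply: mX; exact: addr_ge0.
pose image : {measure set S -> \bar R} :=
  pushforward (mrestr Pr mA) (X (s + t)).
pose nu := image mXst.
have PA : (Pr A < +oo)%E by rewrite (le_lt_trans (probability_le1 Pr mA))// ltry.
have nuE1 B : measurable B ->
    nu B = (\int[Pr]_(w in A) P t (X s w) B)%E.
  by move=> mB; rewrite -XP// setIC.
have nuE2 B : measurable B ->
    nu B = (\int[Pr]_(w in A) \d_(X (s + t) w) B)%E.
  move=> mB; rewrite (eq_integral (fun w => (\1_(X (s + t) @^-1` B) w)%:E)).
    rewrite integral_indic//.
    by rewrite -[X in measurable X]setTI; apply: (mXst).
  by move=> w _; rewrite diracE indicE.
have k1 B : measurable B ->
    measurable_fun setT (fun w => \d_(X (s + t) w) B : \bar R).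
  by move=> mB; apply: (measurableT_comp (measurable_fun_dirac _)).
have k2 B : measurable B -> measurable_fun setT (fun w => P t (X s w) B).
  by move=> mB; apply: (measurableT_comp (measurable_kernel _ _ mB)); exact: mX.
have <- := mean_mixture (mu := Pr) k2 (fun w => prob_kernel _) mA PA nuE1 bphi.
rewrite (mean_mixture (mu := Pr) k1 _ mA PA nuE2 bphi); last first.
  by move=> w /=; rewrite diracT.
apply: eq_Rintegral => w _; rewrite /Rintegral integral_dirac ?diracT ?mul1e//.
exact/measurable_EFinP/bphi.1.
Qed.

End finite_dimensional_laws.

Section cylinders.
Context {R : realType} {dS} {S : measurableType dS}.
Implicit Types (A : R -> set S) (ts : seq R).

Definition cylinder ts A : set (R -> S) := [set f | forall t, t \in ts -> A t (f t)].

(** Probability that a Markov process sitting at [x] at time [s] is in [A t] at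
    every time [t] of the increasing list [ts] of times after [s]. *)
Fixpoint visits (P : R -> R.-pker S ~> S) A (s : R) ts (x : S) : R :=
  if ts is t :: ts' then
    transition P (t - s) (fun y => \1_(A t) y * visits P A t ts' y) x
  else 1.

Lemma visits_bounded P A s ts : (forall t, measurable (A t)) ->
  bounded_measurable (visits P A s ts).
Proof.
move=> mA; elim: ts s => [|t ts IH] s /=; first exact: bounded_measurable_cst.
apply: transition_bounded; apply: bounded_measurableM => //.
exact: bounded_measurable_indic.
Qed.

Section process_visits.
Context {dO} {Omega : measurableType dO}.
Variables (Pr : probability Omega R) (X : R -> Omega -> S).
Hypothesis mX : forall t, 0 <= t -> measurable_fun setT (X t).

Lemma measurable_cylinder ts A : {in ts, forall t, 0 <= t} ->
  (forall t, measurable (A t)) -> measurable [set w | cylinder ts A (X ^~ w)].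
Proof.
move=> ts0 mA.
have -> : [set w | cylinder ts A (X ^~ w)] =
    \big[setI/setT]_(t <- ts) (X t @^-1` A t).
  by rewrite -bigcap_seq; apply/seteqP; split => w /= H t; exact: H.
rewrite big_seq; elim/big_ind: _ => //; first exact: measurableI.
by move=> t tts; rewrite -[X in measurable X]setTI; apply: mX => //; exact: ts0.
Qed.

Variable P : R -> R.-pker S ~> S.
Hypothesis XP : markov_process Pr X P.

(** Induction on the list of times: the visit at the first time [t] is absorbed
    in the event [B] of the past, which becomes an event of the past of [t]. *)
Lemma visitsE s ts A B : 0 <= s -> path <=%R s ts ->
  (forall t, measurable (A t)) -> past X s B ->
  Pr (B `&` [set w | cylinder ts A (X ^~ w)]) =
  (\int[Pr]_(w in B) visits P A s ts (X s w))%:E.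
Proof.
move=> + + mA; elim: ts s B => [|t ts IH] s B s0 /=.
  move=> _ pB; have mB := past_sub_measurable mX pB.
  rewrite (_ : [set w | _] = setT); last by apply/seteqP; split.
  by rewrite setIT Rintegral_cst// mul1r fineK// fin_num_measure.
move=> /andP[st tts] pB; have t0 : 0 <= t by exact: le_trans st.
have mB := past_sub_measurable mX pB.
pose B' := B `&` X t @^-1` A t.
have pB' : past X t B'.
  by apply: past_setI; [exact: past_mono pB|exact: past_preimage].
have -> : B `&` [set w | cylinder (t :: ts) A (X^~ w)] =
    B' `&` [set w | cylinder ts A (X^~ w)].
  apply/seteqP; split => w /= [Bw H].
    split; first by split => //; apply: H; rewrite mem_head.
    by move=> r rts; apply: H; rewrite inE rts orbT.
  split; first by case: Bw.
  by move=> r; rewrite inE => /predU1P[->|/H//]; case: Bw.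
rewrite (IH t)// /B' Rintegral_mkcondr; congr EFin.
pose phi y := \1_(A t) y * visits P A t ts y.
rewrite (@eq_Rintegral _ _ _ Pr B (fun w => phi (X (s + (t - s)) w))); last first.
  move=> w _; rewrite /phi patchE addrC subrK indicE.
  by rewrite (_ : (w \in _) = (X t w \in A t))//; case: ifP; rewrite ?mul1r ?mul0r.
rewrite (markov_mean mX XP)// ?subr_ge0//; apply: bounded_measurableM.
  exact: bounded_measurable_indic.
exact: visits_bounded.
Qed.

Lemma started_cylinder x ts A : started_from Pr X x -> path <=%R 0 ts ->
  (forall t, measurable (A t)) ->
  Pr [set w | cylinder ts A (X ^~ w)] = (visits P A 0 ts x)%:E.
Proof.
move=> X0x ts0 mA; have bv := visits_bounded P 0 ts mA.
rewrite -[X in Pr X]setTI (@visitsE 0)//; last first.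
  by have [_ pC _] := smallest_sigma_algebra setT
    (\bigcup_(r in `[0, 0 : R]) preimage_set_system setT (X r) measurable);
    rewrite -(setD0 setT); apply: pC; exact: sigma_algebra0.
congr EFin; rewrite -[RHS](@mean_cst _ _ _ Pr (probability_setT Pr)).
congr fine; apply: ae_eq_integral => //.
- apply/measurable_EFinP; apply: (measurableT_comp bv.1); exact: mX.
- by apply: filterS X0x => w X0w _; rewrite X0w.
Qed.

End process_visits.

Section intertwined_visits.
Variables (P Q : R -> R.-pker S ~> S) (g : S -> S).
Hypothesis PgQ : forall t psi x, 0 <= t -> bounded_measurable psi ->
  transition P t (psi \o g) x = transition Q t psi (g x).

Lemma visits_intertwine A s ts x : path <=%R s ts ->
  (forall t, measurable (A t)) ->
  visits P (fun t => g @^-1` A t) s ts x = visits Q A s ts (g x).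
Proof.
move=> + mA; elim: ts s x => [//|t ts IH] s x /= /andP[st tts].
rewrite -PgQ ?subr_ge0//; last first.
  apply: bounded_measurableM; last exact: visits_bounded.
  exact: bounded_measurable_indic.
congr (transition _ _ _ _); by apply/funext => y /=; rewrite IH.
Qed.

End intertwined_visits.

Section same_law_cylinders.
Context {dO1} {O1 : measurableType dO1} {dO2} {O2 : measurableType dO2}.
Variables (P1 : probability O1 R) (X1 : R -> O1 -> S).
Variables (P2 : probability O2 R) (X2 : R -> O2 -> S).
Hypothesis mX1 : forall t, 0 <= t -> measurable_fun setT (X1 t).
Hypothesis mX2 : forall t, 0 <= t -> measurable_fun setT (X2 t).

(** Cylinders are stable under intersection and generate the product
    sigma-algebra, so that Dynkin's theorem applies; sorting the list of times
    reduces to increasing lists. *)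
Lemma same_law_cylinder :
  (forall ts A, path <=%R 0 ts -> (forall t, measurable (A t)) ->
    P1 [set w | cylinder ts A (X1 ^~ w)] =
    P2 [set w | cylinder ts A (X2 ^~ w)]) ->
  same_law P1 X1 P2 X2.
Proof.
move=> H C pC.
pose G := [set C | exists ts A, [/\ {in ts, forall t, 0 <= t},
  forall t, measurable (A t) & C = cylinder ts A]].
have GI : setI_closed G.
  move=> _ _ [ts [A [ts0 mA ->]]] [rs [B [rs0 mB ->]]].
  (* A time may belong to only one of the two lists: outside its own list, each
     family of constraints is made trivial. *)
  pose A' t := if t \in ts then A t else setT.
  pose B' t := if t \in rs then B t else setT.
  exists (ts ++ rs), (fun t => A' t `&` B' t); split.
  - by move=> t; rewrite mem_cat => /orP[/ts0|/rs0].
  - by move=> t; apply: measurableI; rewrite /A' /B'; case: ifP.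
  - apply/seteqP; split => f /=.
      move=> [fA fB] t _; rewrite /A' /B'.
      by split; case: ifP => // ?; [exact: fA|exact: fB].
    move=> fAB; split => t tt.
      have [] := fAB t; first by rewrite mem_cat tt.
      by rewrite /A' tt.
    have [] := fAB t; first by rewrite mem_cat tt orbT.
    by rewrite /B' tt.
pose D := [set C | [/\ measurable [set w | C (X1 ^~ w)],
  measurable [set w | C (X2 ^~ w)] &
  P1 [set w | C (X1 ^~ w)] = P2 [set w | C (X2 ^~ w)]]].
suff: D C by case.
have dD : dynkin D.
  split.
  - by split; [exact: measurableT|exact: measurableT|rewrite !probability_setT].
  - move=> E [m1 m2 E12]; split; [exact: measurableC m1|exact: measurableC m2|].
    by rewrite [LHS](probability_setC P1 m1) E12 -probability_setC.
  - move=> F tF DF.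
    have E (Om : Type) (X : R -> Om -> S) :
        [set w | (\bigcup_k F k) (X ^~ w)] = \bigcup_k [set w | F k (X ^~ w)].
      by [].
    have tE (Om : Type) (X : R -> Om -> S) :
        trivIset setT (fun k => [set w | F k (X ^~ w)]).
      by move=> i j _ _ [w [/= Fi Fj]]; apply: tF => //; exists (X ^~ w).
    split.
    + by rewrite E; apply: bigcupT_measurable => k; case: (DF k).
    + by rewrite E; apply: bigcupT_measurable => k; case: (DF k).
    rewrite !E !measure_bigcup//; last 2 first.
    + by move=> k _; case: (DF k).
    + by move=> k _; case: (DF k).
    by apply: eq_eseriesr => k _; case: (DF k).
have : <<s G >> C.
  apply: sub_sigma_algebra2 pC => _ [t [A [t0 mA ->]]].
  exists [:: t], (fun=> A); split => //.
  - by move=> r; rewrite inE => /eqP ->.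
  - apply/seteqP; split => f /= fA; last by apply: fA; rewrite mem_head.
    by move=> r; rewrite inE => /eqP ->.
rewrite -setI_closed_g_dynkin_g_sigma_algebra//; apply: smallest_sub => //.
move=> _ [ts [A [ts0 mA ->]]]; split.
- exact: measurable_cylinder.
- exact: measurable_cylinder.
have -> : cylinder ts A = cylinder (sort <=%R ts) A.
  by apply/seteqP; split => f fA t tt; apply: fA; move: tt; rewrite mem_sort.
apply: H => //; rewrite path_min_sorted ?sort_sorted//; first exact: le_total.
by apply/allP => t; rewrite mem_sort => /ts0.
Qed.

End same_law_cylinders.

End cylinders.

(** * Isometries of Euclidean space *)

Section row_measurability.
Context {R : realType} {d : nat}.
Local Notation E := 'rV[R]_d.

Lemma measurable_coord (i : 'I_d) : measurable_fun setT (fun x : E => x ord0 i).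
Proof.
move=> _ Y mY; rewrite setTI; apply: sub_sigma_algebra => /=.
rewrite -bigcup_seq/=; exists i => /=; first by rewrite mem_index_enum.
by exists Y => //; rewrite setTI.
Qed.

Context {d1} {T : measurableType d1}.

Lemma measurable_rowP (f : T -> E) :
  (forall i, measurable_fun setT (fun t => f t ord0 i)) -> measurable_fun setT f.
Proof.
move=> mf _ Y; rewrite setTI.
suff : (@measurable _ E) `<=` [set Y | measurable (f @^-1` Y)] by apply.
apply: smallest_sub.
  split => /=; first by rewrite preimage_set0.
    by move=> A mA; rewrite setTD preimage_setC; exact: measurableC.
  by move=> F mF; rewrite preimage_bigcup; exact: bigcupT_measurable.
move=> A; rewrite -bigcup_seq => -[i _ [B mB <-]] /=.
by rewrite setTI -[X in measurable X]setTI; exact: mf.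
Qed.

Implicit Types (f g : T -> E) (k : T -> R).

Lemma measurable_rowD f g : measurable_fun setT f -> measurable_fun setT g ->
  measurable_fun setT (fun t => f t + g t).
Proof.
move=> mf mg; apply: measurable_rowP => i; under eq_fun do rewrite mxE.
by apply: measurable_funD;
  exact: (measurableT_comp (measurable_coord i)).
Qed.

Lemma measurable_rowZ k f : measurable_fun setT k -> measurable_fun setT f ->
  measurable_fun setT (fun t => k t *: f t).
Proof.
move=> mk mf; apply: measurable_rowP => i; under eq_fun do rewrite mxE.
by apply: measurable_funM => //; exact: (measurableT_comp (measurable_coord i)).
Qed.

Lemma measurable_rowB f g : measurable_fun setT f -> measurable_fun setT g ->
  measurable_fun setT (fun t => f t - g t).
Proof.
move=> mf mg; apply: measurable_rowP => i; under eq_fun do rewrite !mxE.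
by apply: measurable_funB;
  exact: (measurableT_comp (measurable_coord i)).
Qed.

Lemma measurable_dot f g : measurable_fun setT f -> measurable_fun setT g ->
  measurable_fun setT (fun t => dot (f t) (g t)).
Proof.
move=> mf mg; apply: measurable_sum => i; apply: measurable_funM;
  exact: (measurableT_comp (measurable_coord i)).
Qed.

Lemma measurable_enorm f : measurable_fun setT f ->
  measurable_fun setT (fun t => enorm (f t)).
Proof.
move=> mf; apply: measurableT_comp (measurable_dot mf mf).
apply: continuous_measurable_fun; exact: sqrt_continuous.
Qed.

(* Writing [1 / x] as [x (x ^ 2) ^ (- 1)] reduces inversion to powers of
   nonnegative numbers, and is correct at [0]. *)
Lemma measurable_invr (x : T -> R) : measurable_fun setT x ->
  measurable_fun setT (fun t => (x t)^-1).
Proof.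
move=> mx.
have -> : (fun t => (x t)^-1) = (fun t => x t * powR (x t ^+ 2) (- 1)).
  apply/funext => t; rewrite powR_inv1 ?sqr_ge0//.
  have [->|x0] := eqVneq (x t) 0; first by rewrite invr0 mul0r.
  by rewrite expr2 invfM mulrA divff// mul1r.
apply: measurable_funM => //.
apply: (measurableT_comp (f := @powR R ^~ (- 1))); last exact: measurable_funX.
exact: measurable_powR.
Qed.

Lemma measurable_reflect f g : measurable_fun setT f -> measurable_fun setT g ->
  measurable_fun setT (fun t => reflect_orth (f t) (g t)).
Proof.
move=> mf mg; apply: measurable_rowB => //; apply: measurable_rowZ => //.
apply: measurable_funM; last exact/measurable_invr/measurable_dot.
apply: measurable_funM; [exact: measurable_cst|exact: measurable_dot].
Qed.

End row_measurability.

Section isometries.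
Context {R : realType} {d : nat}.
Local Notation E := 'rV[R]_d.
Implicit Types (x y z : E).

Definition linear_isometry (f : E -> E) :=
  linear f /\ forall x y, dot (f x) (f y) = dot x y.

Lemma enorm_sqr x : enorm x ^+ 2 = dot x x.
Proof. by rewrite sqr_sqrtr// dotxx_ge0. Qed.

Lemma dot0l x : dot 0 x = 0.
Proof. by rewrite /dot big1// => i _; rewrite mxE mul0r. Qed.

Lemma dotBB x y : dot (x - y) (x - y) = dot x x + dot y y - 2 * dot x y.
Proof. by rewrite !dotE (dotC y x); ring. Qed.

Lemma dotDD x y : dot (x + y) (x + y) = dot x x + dot y y + 2 * dot x y.
Proof. by rewrite !dotE (dotC y x); ring. Qed.

Section linear_isometry_theory.
Variable f : E -> E.
Hypothesis isof : linear_isometry f.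

Lemma linear_isometry0 : f 0 = 0.
Proof.
by apply/eqP; rewrite -dotxx_eq0 isof.2 dotxx_eq0.
Qed.

Lemma linear_isometryD x y : f (x + y) = f x + f y.
Proof. by have := isof.1 1 x y; rewrite !scale1r. Qed.

Lemma linear_isometryZ k x : f (k *: x) = k *: f x.
Proof. by have := isof.1 k x 0; rewrite !addr0 linear_isometry0 addr0. Qed.

Lemma linear_isometryB x y : f (x - y) = f x - f y.
Proof. by rewrite -scaleN1r linear_isometryD linear_isometryZ scaleN1r. Qed.

Lemma linear_isometryN x : f (- x) = - f x.
Proof. by rewrite -scaleN1r linear_isometryZ scaleN1r. Qed.

Lemma linear_isometry_inj : injective f.
Proof.
move=> x y fxy; apply/eqP; rewrite -subr_eq0 -dotxx_eq0 -isof.2.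
by rewrite linear_isometryB fxy subrr dot0l.
Qed.

Lemma linear_isometry_mx : {M : 'M[R]_d | forall x, f x = x *m M}.
Proof.
pose fl : {linear E -> E} := HB.pack f (GRing.isLinear.Build R E E _ f isof.1).
by exists (lin1_mx fl) => x; rewrite mul_rV_lin1.
Qed.

(** An isometry is injective, hence has an invertible matrix. *)
Lemma linear_isometry_surj y : exists x, f x = y.
Proof.
have [M fM] := linear_isometry_mx.
suff uM : M \in unitmx by exists (y *m invmx M); rewrite fM mulmxKV.
rewrite -row_free_unit -kermx_eq0; apply/eqP/row_matrixP => i.
apply: linear_isometry_inj; rewrite fM -row_mul mulmx_ker !row0.
by rewrite linear_isometry0.
Qed.

Lemma measurable_linear_isometry : measurable_fun setT f.
Proof.
have [M fM] := linear_isometry_mx.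
apply: measurable_rowP => i; under eq_fun do rewrite fM mxE.
apply: measurable_sum => j; apply: measurable_funM.
  exact: measurable_coord.
exact: measurable_cst.
Qed.

Lemma linear_isometry_enorm x : enorm (f x) = enorm x.
Proof. by rewrite /enorm isof.2. Qed.

Lemma linear_isometry_sphere x : sphere (f x) <-> sphere x.
Proof. by rewrite /sphere /= linear_isometry_enorm. Qed.

Lemma linear_isometry_reflect x y :
  reflect_orth (f y) (f x) = f (reflect_orth y x).
Proof. by rewrite /reflect_orth linear_isometryB linear_isometryZ !isof.2. Qed.

Lemma linear_isometry_sph_coupl a b x :
  sph_coupl (f a) (f b) (f x) = f (sph_coupl a b x).
Proof. by rewrite /sph_coupl -linear_isometryD !linear_isometry_reflect. Qed.

Lemma linear_isometry_half_turn a s x :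
  half_turn (f a) (f s) (f x) = f (half_turn a s x).
Proof.
rewrite /half_turn !isof.2 -linear_isometryZ -linear_isometryB.
by rewrite !linear_isometry_reflect.
Qed.

Lemma linear_isometry_euclid : euclid_isometry f.
Proof.
by move=> x y; rewrite -linear_isometryB linear_isometry_enorm.
Qed.

End linear_isometry_theory.

(** The squared norm of [f (k x + y) - k f x - f y] expands into scalar products
    of images, which may be replaced by those of [x] and [y]. *)
Lemma dot_preserving_linear (f : E -> E) :
  (forall x y, dot (f x) (f y) = dot x y) -> linear f.
Proof.
move=> fD k x y; apply/eqP; rewrite -subr_eq0 -dotxx_eq0 !dotE !fD !dotE.
by rewrite (dotC y x); apply/eqP; ring.
Qed.

(** A distance-preserving map fixing the origin preserves scalar products by
    polarisation. *)
Lemma euclid_isometry_linear (g : E -> E) : euclid_isometry g ->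
  linear_isometry (fun x => g x - g 0).
Proof.
move=> isog; pose f x := g x - g 0.
have fN x : dot (f x) (f x) = dot x x.
  by rewrite -!enorm_sqr /f isog subr0.
have fB x y : dot (f x - f y) (f x - f y) = dot (x - y) (x - y).
  rewrite -!enorm_sqr -[in RHS]isog; congr (enorm _ ^+ 2).
  by rewrite /f opprB addrA subrK.
have fD x y : dot (f x) (f y) = dot x y.
  have := fB x y; rewrite (dotBB (f x)) (dotBB x) !fN => /addrI/oppr_inj/mulfI; apply.
  by rewrite pnatr_eq0.
by split => //; exact: dot_preserving_linear.
Qed.

Lemma reflect_linear_isometry y : linear_isometry (reflect_orth y).
Proof. by split; [exact: reflect_linear|move=> *; exact: reflect_dot]. Qed.

Lemma reflect_swap x y : dot x x = dot y y -> reflect_orth (x - y) x = y.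
Proof.
move=> xy; have [->|xNy] := eqVneq x y.
  by rewrite /reflect_orth subrr scaler0 subr0.
have n0 : dot (x - y) (x - y) != 0 by rewrite dotxx_eq0 subr_eq0.
have dE : dot (x - y) (x - y) = 2 * dot x (x - y).
  by rewrite dotBB -xy dotDr dotNr; ring.
by rewrite /reflect_orth -dE divff// scale1r subKr.
Qed.

End isometries.

(** * Uniqueness of uniformly distributed probabilities *)

Section uniform_uniqueness.
Context {R : realType} {d : nat}.
Local Notation E := 'rV[R]_d.
Implicit Types (x y z : E) (S K : set E) (mu nu : probability E R).

(** The open ball of radius [sqrt r]; the squared radius avoids square roots. *)
Definition near_sq x (r : R) : set E := [set y | dot (y - x) (y - x) < r].

Lemma near_sqC x y r : near_sq x r y = near_sq y r x.
Proof. by rewrite /near_sq /= -opprB dotNl dotNr opprK. Qed.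

Lemma measurable_near_sq {d1} {T : measurableType d1} (f g : T -> E) r :
  measurable_fun setT f -> measurable_fun setT g ->
  measurable [set t | near_sq (f t) r (g t)].
Proof.
move=> mf mg; have mgf : measurable_fun setT (fun t => g t - f t).
  exact: measurable_rowB.
rewrite (_ : [set t | _] = (fun t => dot (g t - f t) (g t - f t) < r) @^-1` [set true]).
  by rewrite -[X in measurable X]setTI;
    apply: (measurable_fun_ltr (measurable_dot mgf mgf) (measurable_cst r)).
by apply/seteqP; split.
Qed.

Lemma measurable_near_sq_center x r : measurable (near_sq x r).
Proof.
exact: (measurable_near_sq (f := fun=> x) (g := id) r (measurable_cst x)).
Qed.

Lemma probability_setI_full mu S K : measurable S -> measurable K ->
  mu S = 1%E -> mu (S `&` K) = mu K.
Proof.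
move=> mS mK S1; rewrite setIC [RHS](measureDI mu mK mS).
rewrite [X in (X + _)%E](_ : _ = 0%E) ?add0e//; apply/eqP.
rewrite -measure_le0; apply: (@le_trans _ _ (mu (~` S))).
  by apply: le_measure; rewrite ?inE; [exact: measurableD|exact: measurableC|move=> ? []].
by rewrite probability_setC// S1 subee.
Qed.

Definition pairing S K r x : set E :=
  [set y | [/\ S x, K x, S y & near_sq x r y]].

Lemma pairing_measure mu nu S K r (h : \bar R) :
  measurable S -> measurable K -> mu S = 1%E -> nu S = 1%E ->
  (forall x, S x -> nu (near_sq x r) = h) ->
  (\int[mu]_x nu (pairing S K r x) = h * mu K)%E.
Proof.
move=> mS mK muS nuS nuh.
rewrite -(probability_setI_full mS mK muS).
rewrite -(@integral_cst _ _ _ mu _ (measurableI _ _ mS mK) h) [RHS]integral_mkcond.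
apply: eq_integral => x _; rewrite patchE; case: ifPn => [/[!inE] -[Sx Kx]|].
  rewrite -(nuh x Sx) -(probability_setI_full mS (measurable_near_sq_center x r) nuS).
  by congr (nu _); apply/seteqP; split => y /= [].
rewrite notin_setE => SKx; rewrite (_ : pairing _ _ _ _ = set0) ?measure0//.
by apply/seteqP; split => y // [Sx Kx _ _]; apply: SKx.
Qed.

Let pairs S K r : set (E * E) := [set z | pairing S K r z.1 z.2].

Let measurable_pairs S K r : measurable S -> measurable K ->
  measurable (pairs S K r).
Proof.
move=> mS mK.
have -> : pairs S K r = (fst @^-1` S `&` fst @^-1` K) `&`
    (snd @^-1` S `&` [set z | near_sq z.1 r z.2]).
  by apply/seteqP; split => -[x y] /= => [[? ? ? ?]|[[? ?] [? ?]]]; split.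
have mfst A : measurable A -> measurable (fst @^-1` A : set (E * E)).
  by move=> mA; rewrite -[X in measurable X]setTI; exact: measurable_fst.
have msnd A : measurable A -> measurable (snd @^-1` A : set (E * E)).
  by move=> mA; rewrite -[X in measurable X]setTI; exact: measurable_snd.
apply: measurableI; apply: measurableI; [exact: mfst|exact: mfst|exact: msnd|].
exact: (measurable_near_sq (f := fst) (g := snd) r measurable_fst measurable_snd).
Qed.

(** Double counting of the pairs of points of [S] at distance less than
    [sqrt r]: weighing the first point with [mu] and the second one with [nu]
    and exchanging the integrals. *)
Lemma pairing_le mu nu S K K' r (hmu hnu : \bar R) :
  measurable S -> measurable K -> measurable K' ->
  mu S = 1%E -> nu S = 1%E ->
  (forall x, S x -> mu (near_sq x r) = hmu) ->
  (forall x, S x -> nu (near_sq x r) = hnu) ->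
  (forall x y, K x -> near_sq x r y -> K' y) ->
  (hnu * mu K <= hmu * nu K')%E.
Proof.
move=> mS mK mK' muS nuS muh nuh KK'.
rewrite -(pairing_measure mS mK muS nuS nuh) -(pairing_measure mS mK' nuS muS muh).
have mP := measurable_pairs r mS mK; have mP' := measurable_pairs r mS mK'.
have -> : (\int[mu]_x nu (pairing S K r x) =
    \int[nu]_y mu (ysection (pairs S K r) y))%E.
  have := indic_fubini_tonelli mu nu mP.
  rewrite indic_fubini_tonelli_FE// indic_fubini_tonelli_GE// => <-.
  by apply: eq_integral => x _; rewrite /= xsectionE.
apply: ge0_le_integral => //.
- exact: measurable_fun_ysection.
- rewrite (_ : (fun _ => _) = mu \o xsection (pairs S K' r)).
    exact: measurable_fun_xsection.
  by apply/funext => y /=; rewrite xsectionE.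
move=> y _; apply: le_measure; rewrite ?inE.
- exact: measurable_ysection.
- have -> : pairing S K' r y = xsection (pairs S K' r) y by rewrite xsectionE.
  exact: measurable_xsection.
rewrite ysectionE => x [Sx Kx Sy xy]; split => //; first exact: KK' xy.
by rewrite near_sqC.
Qed.

(* The step [dl] is chosen so that the [d] coordinates contribute at most
   [d dl ^ 2 = r d / (d + 1) < r]; the [+ 1] covers [d = 0]. *)
Lemma near_sq_cover (r : R) x : 0 < r ->
  exists q : 'rV[rat]_d, near_sq (map_mx ratr q) r x.
Proof.
move=> r0; pose dl := Num.sqrt (r / d.+1%:R).
have dl0 : 0 < dl by rewrite sqrtr_gt0 divr_gt0.
have /choice[q qx] i : exists q : rat, x ord0 i - dl < ratr q < x ord0 i + dl.
  have : x ord0 i - dl < x ord0 i + dl.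
    by rewrite ltrBlDr -addrA ltrDl addr_gt0.
  by move=> /rat_in_itvoo[q]; rewrite in_itv/= => ?; exists q.
exists (\row_i q i); rewrite /near_sq/= /dot.
apply: (@le_lt_trans _ _ (\sum_(i < d) dl ^+ 2)).
  apply: ler_sum => i _; rewrite !mxE -expr2 -[leLHS]real_normK ?num_real//.
  rewrite lerXn2r ?nnegrE ?normr_ge0 ?ltW//.
  by have /andP[q1 q2] := qx i; rewrite ltr_norml; apply/andP; split; lra.
rewrite sumr_const card_ord sqr_sqrtr; last by rewrite divr_ge0// ltW.
by rewrite -[X in X < _]mulr_natr mulrAC ltr_pdivrMr// ltr_pM2l// ltr_nat.
Qed.

(** If balls of radius [sqrt r] centred on [S] were null, so would be [S], which is
    covered by countably many balls of half that radius with rational centres,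
    each of which lies in a ball centred on [S] as soon as it meets [S]. *)
Lemma near_sq_gt0 mu S r (h : \bar R) : measurable S -> mu S = 1%E -> 0 < r ->
  (forall x, S x -> mu (near_sq x r) = h) -> (0 < h)%E.
Proof.
move=> mS muS r0 muh; have r4 : 0 < r / 4 by rewrite divr_gt0.
have [y0 Sy0] : S !=set0.
  apply/set0P/eqP => S0; move: muS; rewrite S0 measure0 => /esym/eqP.
  by rewrite onee_eq0.
rewrite lt0e -{2}(muh y0 Sy0) measure_ge0 andbT; apply/eqP => h0.
pose c (q : 'rV[rat]_d) : set E := S `&` near_sq (map_mx ratr q) (r / 4).
pose F k := if unpickle k is Some q then c q else set0.
have negF k : mu.-negligible (F k).
  rewrite /F; case: unpickle => [q|]; last exact: negligible_set0.
  have [[y [Sy yq]]|cq0] := pselect (c q !=set0); last first.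
    rewrite (_ : c q = set0); first exact: negligible_set0.
    by apply/seteqP; split => // x cx; apply: cq0; exists x.
  exists (near_sq y r); split; [exact: measurable_near_sq_center|by rewrite muh|].
  move=> x [_]; move: yq; rewrite /near_sq/=; set z := map_mx _ _ => yz xz.
  have -> : x - y = (x - z) - (y - z) by rewrite opprB addrA subrK.
  rewrite dotBB.
  have : 0 <= dot ((x - z) + (y - z)) ((x - z) + (y - z)) by exact: dotxx_ge0.
  by rewrite dotDD; lra.
have [N [mN N0 SN]] := negligible_bigcup negF.
have : (mu S <= mu N)%E.
  apply: le_measure; rewrite ?inE// => x Sx; apply: SN.
  have [q xq] := near_sq_cover x r4; exists (pickle q) => //.
  by rewrite /F pickleK.
by rewrite muS N0 lee_fin ler10.
Qed.

(** Orthants with bounds in the extended reals: [-oo] removes the constraint on a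
    coordinate, so that half-spaces and the whole space are orthants too and the
    family is stable under intersection. *)
Definition upper_box (a : 'I_d -> \bar R) : set E :=
  [set x | forall i, (a i <= (x ord0 i)%:E)%E].

Lemma measurable_upper_box a : measurable (upper_box a).
Proof.
have -> : upper_box a =
    \big[setI/setT]_(i <- enum 'I_d) [set x | (a i <= (x ord0 i)%:E)%E].
  rewrite -bigcap_seq; apply/seteqP; split => [x xa i _|x xa i]; first exact: xa.
  by apply: (xa i); rewrite /= mem_enum.
elim/big_ind: _ => [|A B|i _]; [exact: measurableT|exact: measurableI|].
rewrite -[X in measurable X]setTI.
apply: emeasurable_fun_c_infty => //.
by apply/measurable_EFinP; exact: measurable_coord.
Qed.

Lemma upper_box_near a (s : R) x y : 0 < s -> upper_box a x ->
  near_sq x (s ^+ 2) y -> upper_box (fun i => (a i - s%:E)%E) y.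
Proof.
move=> s0 ax xy i; rewrite leeBlDr//; apply: le_trans (ax i) _.
rewrite -EFinD lee_fin -lerBlDl.
have : (y - x) ord0 i ^+ 2 <= s ^+ 2.
  apply: le_trans (ltW xy); rewrite expr2 /dot (bigD1 i)//= lerDl.
  by apply: sumr_ge0 => j _; rewrite -expr2 sqr_ge0.
rewrite -[leLHS]real_normK ?num_real// ler_sqr ?nnegrE//; last exact: ltW.
by rewrite ler_norml !mxE => /andP[+ _]; lra.
Qed.

(** Every point near the box [a] lies in the box [a - s]. The double counting
    lemma thus gives [hnu mu (box a) <= hmu nu (box (a - s))], and with the whole
    space in place of boxes it gives [hmu <= hnu]. After simplification [s] tends
    to [0]. *)
Lemma upper_box_le mu nu S a : measurable S -> mu S = 1%E -> nu S = 1%E ->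
  (forall r x y, 0 < r -> S x -> S y -> mu (near_sq x r) = mu (near_sq y r)) ->
  (forall r x y, 0 < r -> S x -> S y -> nu (near_sq x r) = nu (near_sq y r)) ->
  (mu (upper_box a) <= nu (upper_box a))%E.
Proof.
move=> mS muS nuS mur nur.
have [y0 Sy0] : S !=set0.
  apply/set0P/eqP => S0; move: muS; rewrite S0 measure0 => /esym/eqP.
  by rewrite onee_eq0.
have step (s : R) : 0 < s ->
    (mu (upper_box a) <= nu (upper_box (fun i => a i - s%:E)%E))%E.
  move=> s0; have r0 : 0 < s ^+ 2 by rewrite exprn_gt0.
  set r := s ^+ 2 in r0.
  pose hmu := mu (near_sq y0 r); pose hnu := nu (near_sq y0 r).
  have muh x : S x -> mu (near_sq x r) = hmu by move=> Sx; exact: mur.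
  have nuh x : S x -> nu (near_sq x r) = hnu by move=> Sx; exact: nur.
  have hmu0 : (0 < hmu)%E by exact: near_sq_gt0 muh.
  have hmufin : hmu \is a fin_num.
    by apply: fin_num_measure; exact: measurable_near_sq_center.
  have hle : (hmu <= hnu)%E.
    have := @pairing_le nu mu S setT setT r hnu hmu mS measurableT measurableT
      nuS muS nuh muh (fun _ _ _ _ => I).
    by rewrite [X in (_ * X <= _)%E]probability_setT
      [X in (_ <= _ * X)%E]probability_setT !mule1.
  have := pairing_le mS (measurable_upper_box a)
    (measurable_upper_box (fun i => a i - s%:E)%E) muS nuS muh nuh
    (fun x y => @upper_box_near a s x y s0).
  move=> H; rewrite -(@lee_pmul2l _ hmu)//; apply: le_trans H.
  by apply: lee_wpmul2r.
pose B (n : nat) := upper_box (fun i => a i - n.+1%:R^-1%:E)%E.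
have aE : upper_box a = \bigcap_n B n.
  apply/seteqP; split => x xa.
    by move=> n _ i; rewrite leeBlDr// (le_trans (xa i))// leeDl// lee_fin.
  move=> i; apply/lee_addgt0Pr => e e0.
  have [n ne] : exists n : nat, n.+1%:R^-1 < e.
    have [n _ /(_ n (leqnn n))/= ne] := near_infty_natSinv_lt (PosNum e0).
    by exists n.
  have := xa n I i; rewrite leeBlDr// => /le_trans; apply.
  by rewrite leeD2l// lee_fin ltW.
have mB n : measurable (B n) by exact: measurable_upper_box.
have niB : nonincreasing_seq B.
  move=> m n mn; apply/subsetPset => x xB i; apply: le_trans (xB i).
  rewrite leeB// lee_fin lef_pV2 ?posrE ?ltr0n//.
  by rewrite ler_nat.
have mIB : measurable (\bigcap_n B n) by exact: bigcapT_measurable.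
have nuB : (nu (B 0%N) < +oo)%E.
  by rewrite (le_lt_trans (probability_le1 nu (mB _)))// ltry.
rewrite [in leRHS]aE.
have cvB := nonincreasing_cvg_mu nuB mB mIB niB.
rewrite -[leRHS](cvg_lim _ cvB)//; apply: lime_ge.
  by apply/cvg_ex; eexists; exact: cvB.
by apply: nearW => n; apply: step; rewrite invr_gt0.
Qed.

Let upper_boxes : set (set E) := range upper_box.

Lemma measurable_upper_boxes : @measurable _ E = <<s upper_boxes >>.
Proof.
apply/seteqP; split; last first.
  apply: smallest_sub; first exact: sigma_algebra_measurable.
  by move=> _ [a _ <-]; exact: measurable_upper_box.
apply: smallest_sub; first exact: smallest_sigma_algebra.
move=> A; rewrite -bigcup_seq => -[i _ [B mB <-]].
pose f : g_sigma_algebraType upper_boxes -> R := fun x : E => x ord0 i.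
suff : measurable_fun setT f by move=> /(_ measurableT B mB).
apply: (measurability (@RGenCInfty.G R)) => [|/= _ [_] [r] -> <-].
  exact: RGenCInfty.measurableE.
apply: sub_sigma_algebra; exists (fun j => if j == i then r%:E else -oo%E) => //.
rewrite setTI; apply/seteqP; split => x /=.
  by move=> /(_ i); rewrite eqxx lee_fin in_itv/= andbT.
by rewrite in_itv/= andbT => rx j; case: eqP => [->|_]; rewrite ?lee_fin ?leNye.
Qed.

(** By the comparison above, used in both directions, [mu] and [nu] agree on
    orthants. When a group of isometries acts transitively on [S], invariant
    probabilities satisfy the hypothesis on balls: this is how uniqueness of the
    uniform law is obtained here, in place of averaging over the group. *)
Lemma uniformly_distributed_unique mu nu S A :
  measurable S -> mu S = 1%E -> nu S = 1%E ->
  (forall r x y, 0 < r -> S x -> S y -> mu (near_sq x r) = mu (near_sq y r)) ->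
  (forall r x y, 0 < r -> S x -> S y -> nu (near_sq x r) = nu (near_sq y r)) ->
  measurable A -> mu A = nu A.
Proof.
move=> mS muS nuS mur nur.
apply: (measure_unique upper_boxes (fun=> setT)).
- exact: measurable_upper_boxes.
- move=> _ _ [a _ <-] [b _ <-]; exists (fun i => maxe (a i) (b i)) => //.
  apply/seteqP; split => x /= H.
    by split => i; have := H i; rewrite ge_max => /andP[].
  by move=> i; rewrite ge_max; case: H => -> ->.
- move=> _; exists (fun=> -oo%E) => //; apply/seteqP; split => // x _ i.
  by rewrite leNye.
- by rewrite bigcup_const//; exists 0%N.
- by move=> _ [a _ <-]; apply/eqP; rewrite eq_le !(upper_box_le (S := S)).
- by move=> k; rewrite (le_lt_trans (probability_le1 _ _))// ltry.
Qed.

End uniform_uniqueness.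

(** * Isotropic laws *)

Section probabilities_of_unit_mass.
Context {R : realType} {d} {T : measurableType d}.

Section probability_of.
Variables (m : {measure set T -> \bar R}) (m1 : m setT = 1%E).

(** A copy of [m] on which the structure of probability is declared. *)
Definition unit_mass of m setT = 1%E : set T -> \bar R := m.

HB.instance Definition _ := Measure.on (unit_mass m1).

HB.instance Definition _ := Measure_isProbability.Build _ _ _ (unit_mass m1) m1.

Definition probability_of : probability T R := unit_mass m1.

End probability_of.

Variable m : {measure set T -> \bar R}.
Hypothesis m1 : m setT = 1%E.

Lemma bounded_unit_integrable (f : T -> R) : bounded_measurable f ->
  m.-integrable setT (EFin \o f).
Proof. by apply: bounded_integrable; rewrite m1 ltry. Qed.

Lemma integral_pushforward_bounded {d'} {T' : measurableType d'}
    (h : T -> T') (f : T' -> R) :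
  measurable_fun setT h -> bounded_measurable f ->
  (\int[pushforward m h]_y (f y)%:E = \int[m]_x (f (h x))%:E)%E.
Proof.
move=> mh bf; rewrite integral_pushforward//.
- exact/measurable_EFinP/bf.1.
- exact/bounded_unit_integrable/bounded_measurable_comp.
Qed.

Lemma integral_image {d'} {T' : measurableType d'}
    (nu : {measure set T' -> \bar R}) (h : T -> T') (f : T' -> R) :
  measurable_fun setT h -> bounded_measurable f ->
  (forall A, measurable A -> nu A = m (h @^-1` A)) ->
  (\int[nu]_y (f y)%:E = \int[m]_x (f (h x))%:E)%E.
Proof.
move=> mh bf nuE; pose image : {measure set T' -> \bar R} := pushforward m h.
rewrite (eq_measure_integral (image mh)) => [|A mA _]; last exact: nuE.
exact: integral_pushforward_bounded.
Qed.

Lemma integral_le0_full (S : set T) (f : T -> R) :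
  measurable S -> m S = 1%E -> bounded_measurable f ->
  (forall x, S x -> f x <= 0) -> (\int[m]_x (f x)%:E <= 0)%E.
Proof.
move=> mS mS1 bf f0.
pose g x := f x * \1_S x.
have bg : bounded_measurable g.
  exact: bounded_measurableM bf (bounded_measurable_indic mS).
have g0 x : g x <= 0.
  rewrite /g indicE; case: (boolP (x \in S)) => [|_]; last by rewrite mulr0.
  by rewrite inE mulr1; exact: f0.
rewrite (ae_eq_integral (fun x => (g x)%:E))//.
- rewrite (eq_integral (fun x => - (- g x)%:E)%E) => [|x _]; last first.
    by rewrite -EFinN opprK.
  rewrite integral_ge0N => [|x _]; last by rewrite lee_fin oppr_ge0.
  by rewrite oppe_le0; apply: integral_ge0 => x _; rewrite lee_fin oppr_ge0.
- exact/measurable_EFinP/bf.1.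
- exact/measurable_EFinP/bg.1.
exists (~` S); split; first exact: measurableC.
  have := probability_setC (probability_of m1) mS.
  by rewrite /= /unit_mass mS1 subee.
move=> x /= fgx Sx; apply: fgx => _; rewrite /g indicE mem_set ?mulr1//.
Qed.

End probabilities_of_unit_mass.

Section linear_isometry_laws.
Context {R : realType} {d : nat}.
Local Notation E := 'rV[R]_d.
Variables (c : R.-pker (R * E)%type ~> E) (hc : isotropic_transition c).
Variables (sigma : probability E R) (hsigma : uniform_on (@sphere R d) sigma).
Implicit Types (theta : R) (n a b s x y : E).

Lemma near_sq_isometry (f : E -> E) x r : linear_isometry f ->
  f @^-1` near_sq (f x) r = near_sq x r.
Proof.
move=> isof; apply/seteqP; split => y; rewrite /near_sq /=;
  by rewrite -linear_isometryB// isof.2.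
Qed.

Lemma measurable_sphere : measurable (@sphere R d).
Proof.
rewrite (_ : sphere = (fun x : E => enorm x) @^-1` [set 1]).
  rewrite -[X in measurable X]setTI; apply: measurable_enorm => //.
by apply/seteqP; split.
Qed.

Lemma measurable_sphere_slice n theta : measurable (sphere_slice n theta).
Proof.
rewrite (_ : sphere_slice n theta =
    sphere `&` (fun x : E => dot n x) @^-1` [set cos theta]).
  apply: measurableI; first exact: measurable_sphere.
  rewrite -[X in measurable X]setTI.
  by apply: (measurable_dot (f := fun=> n) (g := id)).
by apply/seteqP; split.
Qed.

Lemma sphere_slice_isometry (f : E -> E) n theta : linear_isometry f ->
  f @^-1` sphere_slice (f n) theta = sphere_slice n theta.
Proof.
move=> isof; apply/seteqP; split => x; rewrite /sphere_slice/= isof.2 => -[sx <-].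
  by split => //; exact/(linear_isometry_sphere isof).
by split => //; exact/(linear_isometry_sphere isof).
Qed.

(** The slice is homogeneous because the reflection exchanging two of its points
    fixes [n], hence preserves the slice. *)
Lemma isotropic_near_sq theta n r x y : 0 <= theta <= pi -> sphere n ->
  sphere_slice n theta x -> sphere_slice n theta y ->
  c (theta, n) (near_sq x r) = c (theta, n) (near_sq y r).
Proof.
move=> ht sn [/sphere_dot x1 nx] [/sphere_dot y1 ny].
have isor := reflect_linear_isometry (x - y).
have rxy : reflect_orth (x - y) x = y by rewrite reflect_swap// x1.
have rn : reflect_orth (x - y) n = n.
  by rewrite reflect_fix// dotDr dotNr nx ny subrr.
have [_ inv] := hc ht sn.
have fixS : reflect_orth (x - y) @^-1` sphere_slice n theta = sphere_slice n theta.
  by have := sphere_slice_isometry n theta isor; rewrite rn.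
have := inv _ (linear_isometry_euclid isor) fixS _ (measurable_near_sq_center y r).
by rewrite -(near_sq_isometry x r isor) rxy.
Qed.

(** The image of the uniform law on the slice of [n] by the isometry [f] is
    uniformly distributed on the slice of [f n], as is the law
    [c (theta, f n)]. *)
Lemma isotropic_push (f : E -> E) theta n A : linear_isometry f ->
  0 <= theta <= pi -> sphere n -> measurable A ->
  c (theta, f n) A = c (theta, n) (f @^-1` A).
Proof.
move=> isof ht sn mA; have mf := measurable_linear_isometry isof.
have sfn : sphere (f n) by exact/(linear_isometry_sphere isof).
pose image : {measure set E -> \bar R} :=
  pushforward (c (theta, n)) f.
pose nu := image mf.
have nu1 : nu setT = 1%E by rewrite /nu /= /pushforward preimage_setT prob_kernel.
have mu1 : c (theta, f n) setT = 1%E by exact: prob_kernel.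
pose mu' := probability_of mu1.
pose nu' := probability_of nu1.
rewrite -[LHS]/(mu' A) -[RHS]/(nu' A).
apply: (@uniformly_distributed_unique _ _ mu' nu' (sphere_slice (f n) theta)) => //.
- exact: measurable_sphere_slice.
- by have [] := hc ht sfn.
- rewrite /= /nu /= /pushforward sphere_slice_isometry//.
  by have [] := hc ht sn.
- by move=> r x y _; exact: isotropic_near_sq.
- move=> r x y _ + +.
  have [x' <-] := linear_isometry_surj isof x.
  have [y' <-] := linear_isometry_surj isof y.
  have pre z : sphere_slice (f n) theta (f z) = sphere_slice n theta z.
    by rewrite -(sphere_slice_isometry n theta isof).
  rewrite !pre.
  rewrite /= /nu /= /pushforward !near_sq_isometry//.
  exact: isotropic_near_sq.
Qed.

Lemma isotropic_mean_push (f : E -> E) theta n (h : E -> R) : linear_isometry f ->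
  0 <= theta <= pi -> sphere n -> bounded_measurable h ->
  (\int[c (theta, f n)]_x (h x)%:E = \int[c (theta, n)]_x (h (f x))%:E)%E.
Proof.
move=> isof ht sn bh; have mf := measurable_linear_isometry isof.
apply: integral_image => //; first exact: prob_kernel.
by move=> A mA; exact: isotropic_push.
Qed.

Lemma uniform_sphere_push (f : E -> E) (h : E -> R) : linear_isometry f ->
  bounded_measurable h ->
  (\int[sigma]_x (h (f x))%:E = \int[sigma]_x (h x)%:E)%E.
Proof.
move=> isof bh; have mf := measurable_linear_isometry isof.
apply/esym/integral_image => //; first exact: probability_setT.
move=> A mA; apply/esym/hsigma.2 => //; first exact: linear_isometry_euclid.
by apply/seteqP; split => x /(linear_isometry_sphere isof).
Qed.

End linear_isometry_laws.

(** * The spherical coupling *)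

Section coupling_maps.
Context {R : realType} {d : nat}.
Local Notation E := 'rV[R]_d.
Implicit Types (a b s x y : E).

(** A single family of maps for both cases of the coupling of directions; [s]
    stands for the auxiliary uniform point of the antipodal case. *)
Definition coupling_map a b s x : E :=
  if a != - b then sph_coupl a b x else half_turn a s x.

Lemma coupling_map_isometry a b s : linear_isometry (coupling_map a b s).
Proof.
rewrite /coupling_map; case: (a != - b); split.
- exact: sph_coupl_linear.
- exact: sph_coupl_dot.
- exact: half_turn_linear.
- exact: half_turn_dot.
Qed.

Lemma coupling_map_src a b s : sphere a -> sphere b -> coupling_map a b s a = b.
Proof.
move=> sa sb; rewrite /coupling_map; case: ifPn => [|/negPn/eqP ->].
  exact: sph_coupl_src.
by rewrite half_turn_l opprK.
Qed.

Lemma coupling_map_equivariant f a b s x : linear_isometry f ->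
  coupling_map (f a) (f b) (f s) (f x) = f (coupling_map a b s x).
Proof.
move=> isof; rewrite /coupling_map -linear_isometryN//.
rewrite (inj_eq (linear_isometry_inj isof)); case: ifP => _.
  exact: linear_isometry_sph_coupl.
exact: linear_isometry_half_turn.
Qed.

Lemma measurable_coupling_map a b :
  measurable_fun setT (fun z : E * E => coupling_map a b z.2 z.1).
Proof.
rewrite /coupling_map; case: (a != - b).
  apply: (measurableT_comp (f := sph_coupl a b)) => //.
  exact: measurable_linear_isometry (conj (sph_coupl_linear a b) (sph_coupl_dot a b)).
apply: measurable_reflect.
  apply: measurable_rowB => //; apply: measurable_rowZ => //.
  apply: measurable_funM => //; exact: measurable_dot.
exact: measurable_reflect.
Qed.

(** Nonnegativity of the Gram determinant of [a], [b], [x]: the squared norm of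
    [1 - k ^ 2] times the component of [x] orthogonal to [a] and [b]. *)
Lemma gram_ge0 a b x (k al be : R) :
  dot a a = 1 -> dot b b = 1 -> dot x x = 1 ->
  dot a b = k -> dot x a = al -> dot x b = be -> k ^+ 2 < 1 ->
  al ^+ 2 + be ^+ 2 - 2 * k * al * be <= 1 - k ^+ 2.
Proof.
move=> aa bb xx ab xa xb k1.
have k10 : 0 < 1 - k ^+ 2 by rewrite subr_gt0.
have := dotxx_ge0 ((1 - k ^+ 2) *: x - (al - k * be) *: a - (be - k * al) *: b).
rewrite !dotE (dotC b a) (dotC a x) (dotC b x) aa bb xx ab xa xb => gram.
rewrite -subr_ge0 -(pmulr_rge0 _ k10); apply: le_trans gram _.
by rewrite le_eqVlt; apply/orP; left; apply/eqP; ring.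
Qed.

Lemma sphere_dot_le1 a b : sphere a -> sphere b -> `|dot a b| <= 1.
Proof.
move=> /sphere_dot aa /sphere_dot bb; rewrite ler_norml.
have := dotxx_ge0 (a + b); have := dotxx_ge0 (a - b).
rewrite dotBB dotDD aa bb => ? ?; apply/andP; split; lra.
Qed.

(** The rotation bringing [a] to [b] moves no point of the sphere by a larger
    angle than it moves [a], because it only acts on the component of [x] in the
    plane of [a] and [b], whose norm is at most one. *)
Lemma sph_coupl_contract a b x : sphere a -> sphere b -> sphere x -> a != - b ->
  dot a b <= dot x (sph_coupl a b x).
Proof.
move=> sa sb sx ab0; have kle := sphere_dot_le1 sa sb.
have n0 := dot_addxx_neq0 ab0.
move: sa sb sx => /sphere_dot aa /sphere_dot bb /sphere_dot xx.
move: kle n0; rewrite dotDD aa bb.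
rewrite /sph_coupl /reflect_orth dotDD aa bb !dotE aa xx.
move E1 : (dot a b) => k; move E2 : (dot x a) => al; move E3 : (dot x b) => be.
move=> kle n0.
have k0 : 0 < 1 + k.
  rewrite lt_neqAle; apply/andP; split.
    by apply: contra_neq n0 => ?; lra.
  by move: kle; rewrite ler_norml; lra.
have -> : 1 - 2 * al / 1 * al - 2 * (al + be + (- (2 * al / 1 * 1) - 2 * al / 1 * k)) /
    (1 + 1 + 2 * k) * (al + be) =
  1 - (al ^+ 2 + be ^+ 2 - 2 * k * al * be) / (1 + k).
  by field; rewrite gt_eqF//; lra.
rewrite lerBrDl -lerBrDr ler_pdivrMr//.
have -> : (1 - k) * (1 + k) = 1 - k ^+ 2 by ring.
(* The Gram inequality degenerates for [a = b], where both sides vanish. *)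
have [k1|k1] := ltP (k ^+ 2) 1; first exact: (gram_ge0 aa bb xx).
have k1' : k = 1.
  have : (1 - k) * (1 + k) <= 0 by rewrite (_ : _ * _ = 1 - k ^+ 2); [lra|ring].
  rewrite pmulr_lle0// => k1'; apply/eqP; rewrite eq_le.
  by move: kle; rewrite ler_norml => /andP[_ ->]; lra.
have : a = b.
  apply/eqP; rewrite -subr_eq0 -dotxx_eq0 dotBB aa bb E1 k1'; apply/eqP; ring.
move=> ab; rewrite -E3 -ab E2 k1' expr1n le_eqVlt; apply/orP; left.
by apply/eqP; ring.
Qed.

Lemma coupling_map_contract a b s x : sphere a -> sphere b -> sphere x ->
  dot a b <= dot x (coupling_map a b s x).
Proof.
move=> sa sb sx; rewrite /coupling_map; case: ifPn => [|/negPn/eqP aNb].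
  exact: sph_coupl_contract.
have shx : sphere (half_turn a s x).
  by apply/sphere_dot; rewrite half_turn_dot; apply/sphere_dot.
rewrite aNb dotNl (sphere_dot b).1//; move: (sphere_dot_le1 sx shx).
by rewrite aNb ler_norml => /andP[].
Qed.

End coupling_maps.

Section coupled_integrals.
Context {R : realType} {d : nat}.
Local Notation E := 'rV[R]_d.
Variables (c : R.-pker (R * E)%type ~> E) (hc : isotropic_transition c).
Variables (sigma : probability E R) (hsigma : uniform_on (@sphere R d) sigma).
Implicit Types (theta : R) (a b s x y : E) (f : E * E -> R).

Let c1 theta a : c (theta, a) setT = 1%E. Proof. exact: prob_kernel. Qed.

(** Both cases of the coupled transition as one average over [s]: for each [s]
    the second direction is the image of the first one by a linear isometry
    sending [a] to [b]. The equivariance and marginal formulas below follow from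
    this description. *)
Lemma coupled_integralE theta a b f : bounded_measurable f ->
  (\int[coupled_transition c sigma theta a b]_z (f z)%:E =
   \int[sigma]_s \int[c (theta, a)]_x (f (x, coupling_map a b s x))%:E)%E.
Proof.
move=> bf; rewrite /coupled_transition /coupling_map; case: ifPn => ab.
  rewrite (integral_pushforward_bounded (c1 theta a))//; last first.
    apply: measurable_fun_pair => //.
    exact: measurable_linear_isometry (conj (sph_coupl_linear a b) (sph_coupl_dot a b)).
  rewrite integral_cst// [X in (_ * X)%E](_ : _ = 1%E) ?mule1//.
  exact: probability_setT.
pose ca := probability_of (c1 theta a).
pose h (z : E * E) := (z.1, half_turn a z.2 z.1).
have mh : measurable_fun setT h.
  apply: measurable_fun_pair => //.
  by have := measurable_coupling_map a b; rewrite /coupling_map (negbTE ab).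
have bfh : bounded_measurable (f \o h) by exact: bounded_measurable_comp.
have prod1 : (ca \x sigma)%E setT = 1%E.
  rewrite -setXTT product_measure1E// [X in (X * _)%E](c1 theta a).
  by rewrite mul1e; exact: probability_setT.
rewrite -[LHS]/(\int[pushforward (ca \x sigma)%E h]_z (f z)%:E)%E.
rewrite (integral_pushforward_bounded prod1)//.
rewrite -(@integral21_prod_meas1 _ _ _ _ _ ca sigma)//.
exact: bounded_unit_integrable.
Qed.

Lemma coupled_inner_bounded theta a (h : E * E -> R) : bounded_measurable h ->
  bounded_measurable (fun s => \int[c (theta, a)]_x h (x, s)).
Proof.
move=> bh; pose ca := probability_of (c1 theta a).
have prod1 : (ca \x sigma)%E setT = 1%E.
  rewrite -setXTT product_measure1E// [X in (X * _)%E](c1 theta a).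
  by rewrite mul1e; exact: probability_setT.
split.
  apply: measurableT_comp; first exact: fine_measurable.
  apply: (@measurable_fubini_G _ _ _ _ _ ca sigma (EFin \o h)).
  exact: bounded_unit_integrable.
have [_ [M hM]] := bh; exists M => s.
apply: mean_norm_le => //; apply: (bounded_measurable_comp bh).
exact: measurable_fun_pair.
Qed.

Lemma coupled_integral_push (g : E -> E) theta a b f : linear_isometry g ->
  0 <= theta <= pi -> sphere a -> bounded_measurable f ->
  (\int[coupled_transition c sigma theta (g a) (g b)]_z (f z)%:E =
   \int[coupled_transition c sigma theta a b]_z (f (g z.1, g z.2))%:E)%E.
Proof.
move=> isog ht sa bf; have mg := measurable_linear_isometry isog.
have mgg : measurable_fun setT (fun z : E * E => (g z.1, g z.2)).
  apply: measurable_fun_pair; exact: measurableT_comp.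
rewrite !coupled_integralE//; last exact: (bounded_measurable_comp bf mgg).
pose h (z : E * E) := f (z.1, coupling_map (g a) (g b) z.2 z.1).
have bh : bounded_measurable h.
  apply: (bounded_measurable_comp bf); apply: measurable_fun_pair => //.
  exact: measurable_coupling_map.
pose h' (z : E * E) := h (g z.1, z.2).
have bh' : bounded_measurable h'.
  apply: (bounded_measurable_comp bh); apply: measurable_fun_pair => //.
  exact: measurableT_comp.
have bs (k : E * E -> R) s : bounded_measurable k ->
    bounded_measurable (fun x => k (x, s)).
  move=> bk; apply: (bounded_measurable_comp bk).
  exact: measurable_fun_pair.
pose K s := \int[c (theta, a)]_x h' (x, s).
have KE s : (\int[c (theta, a)]_x (h' (x, s))%:E = (K s)%:E)%E.
  rewrite /K /Rintegral fineK//; apply: integrable_fin_num => //.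
  by apply: bounded_unit_integrable; [exact: c1|exact: bs].
transitivity (\int[sigma]_s (K s)%:E)%E.
  apply: eq_integral => s _; rewrite -KE.
  exact: (isotropic_mean_push hc isog ht sa (bs h s bh)).
rewrite -(uniform_sphere_push hsigma isog); last exact: coupled_inner_bounded.
apply: eq_integral => s _; rewrite -KE; apply: eq_integral => x _.
by rewrite /h' /h/= coupling_map_equivariant.
Qed.

Lemma coupled_marginal1 theta a b (h : E -> R) : bounded_measurable h ->
  (\int[coupled_transition c sigma theta a b]_z (h z.1)%:E =
   \int[c (theta, a)]_x (h x)%:E)%E.
Proof.
move=> bh; rewrite (coupled_integralE _ _ _ (f := h \o fst)); last first.
  exact: bounded_measurable_comp.
rewrite /= integral_cst// [X in (_ * X)%E](_ : _ = 1%E) ?mule1//.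
exact: probability_setT.
Qed.

(** For each [s], the map [coupling_map a b s] sends the isotropic law around [a]
    to the isotropic law around [b]. *)
Lemma coupled_marginal2 theta a b (h : E -> R) : 0 <= theta <= pi ->
  sphere a -> sphere b -> bounded_measurable h ->
  (\int[coupled_transition c sigma theta a b]_z (h z.2)%:E =
   \int[c (theta, b)]_x (h x)%:E)%E.
Proof.
move=> ht sa sb bh; rewrite (coupled_integralE _ _ _ (f := h \o snd)); last first.
  exact: bounded_measurable_comp.
transitivity (\int[sigma]_s \int[c (theta, b)]_x (h x)%:E)%E.
  apply: eq_integral => s _ /=.
  rewrite -(isotropic_mean_push hc (coupling_map_isometry a b s))//.
  by rewrite coupling_map_src.
rewrite integral_cst// [X in (_ * X)%E](_ : _ = 1%E) ?mule1//.
exact: probability_setT.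
Qed.

(** Up to a null set the first direction is on the sphere, and then the coupling
    makes the two directions at least as close as [a] and [b]. *)
Lemma coupled_integral_le0 theta a b f : 0 <= theta <= pi ->
  sphere a -> sphere b -> bounded_measurable f ->
  (forall x y, sphere x -> sphere y -> dot a b <= dot x y -> f (x, y) <= 0) ->
  (\int[coupled_transition c sigma theta a b]_z (f z)%:E <= 0)%E.
Proof.
move=> ht sa sb bf f0; rewrite coupled_integralE//.
have bh s : bounded_measurable (fun x => f (x, coupling_map a b s x)).
  apply: (bounded_measurable_comp bf); apply: measurable_fun_pair => //.
  by apply: measurable_linear_isometry; exact: coupling_map_isometry.
have le0 s : (\int[c (theta, a)]_x (f (x, coupling_map a b s x))%:E <= 0)%E.
  apply: (integral_le0_full (c1 theta a) (measurable_sphere_slice a theta)) => //.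
    by have [] := hc ht sa.
  move=> x [sx _]; apply: f0 => //; last exact: coupling_map_contract.
  exact/(linear_isometry_sphere (coupling_map_isometry a b s)).
rewrite (eq_integral (fun s => - - \int[c (theta, a)]_x (f (x, coupling_map a b s x))%:E)%E).
  rewrite integral_ge0N => [|x _]; last by rewrite oppe_ge0.
  by rewrite oppe_le0; apply: integral_ge0 => s _; rewrite oppe_ge0.
by move=> s _; rewrite oppeK.
Qed.

End coupled_integrals.

(** * Coupled collisions *)

Section collisions.
Context {R : realType} {d : nat}.
Local Notation E := 'rV[R]_d.
Local Notation two_body := ((E * E) * (E * E))%type.
Implicit Types (u x y p : E) (z : two_body).

Lemma enorm_ge0 x : 0 <= enorm x. Proof. exact: sqrtr_ge0. Qed.

Lemma enorm_eq0 x : (enorm x == 0) = (x == 0).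
Proof. by rewrite -sqrf_eq0 enorm_sqr dotxx_eq0. Qed.

Lemma sphere_direction e p : sphere e -> sphere (direction e p).
Proof.
rewrite /direction; case: eqVneq => // p0 _; apply/sphere_dot.
rewrite dotZl dotZr -enorm_sqr mulrA -invfM -expr2 mulVf//.
by rewrite sqrf_eq0 enorm_eq0.
Qed.

Lemma enorm_direction e p : enorm p *: direction e p = p.
Proof.
rewrite /direction; case: eqVneq => [->|p0].
  by rewrite (_ : enorm 0 = 0) ?scale0r//; apply/eqP; rewrite enorm_eq0.
by rewrite scalerA divff ?scale1r// enorm_eq0.
Qed.

Lemma direction_isometry e p (f : E -> E) : linear_isometry f -> p != 0 ->
  direction e (f p) = f (direction e p).
Proof.
move=> isof p0; rewrite /direction (negbTE p0).
rewrite -(inj_eq (linear_isometry_inj isof)) linear_isometry0// in p0.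
by rewrite (negbTE p0) linear_isometry_enorm// linear_isometryZ.
Qed.

Definition two_body_map (g : E -> E) z : two_body :=
  ((g z.1.1, g z.1.2), (g z.2.1, g z.2.2)).

Lemma post_collision_isometry (g : E -> E) u u' x : euclid_isometry g ->
  post_collision (g u) (g u') (g x - g 0) =
  (g (post_collision u u' x).1, g (post_collision u u' x).2).
Proof.
move=> isog; have isof := euclid_isometry_linear isog.
rewrite /post_collision isog /=; set k := 2^-1 * enorm _.
pose f x := g x - g 0; rewrite -/f in isof; rewrite -/(f x).
have gE y : g y = f y + g 0 by rewrite /f subrK.
move: (g 0) gE => g0 gE; clearbody f.
have hE : 2^-1 *: (g u + g u') = f (2^-1 *: (u + u')) + g0.
  rewrite (linear_isometryZ isof) (linear_isometryD isof) (gE u) (gE u').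
  by apply/rowP => i; rewrite !mxE; field.
rewrite hE -(linear_isometryZ isof) !gE (linear_isometryD isof).
rewrite (linear_isometryB isof).
by rewrite addrAC; congr (_, _); rewrite addrAC.
Qed.

Lemma coupled_collisionE z n : coupled_collision z n =
  (((post_collision z.1.1 z.2.1 n.1).1, (post_collision z.1.2 z.2.2 n.2).1),
   ((post_collision z.1.1 z.2.1 n.1).2, (post_collision z.1.2 z.2.2 n.2).2)).
Proof. by case: z => [[u v] [us vs]]. Qed.

Lemma coupled_collision_isometry (g : E -> E) z x y : euclid_isometry g ->
  coupled_collision (two_body_map g z) (g x - g 0, g y - g 0) =
  two_body_map g (coupled_collision z (x, y)).
Proof.
move=> isog; rewrite !coupled_collisionE [(_, _).1]/= [(_, _).2]/=.
by rewrite !post_collision_isometry.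
Qed.

(** The pre-collisional velocities are the outcome of the collision that keeps the
    directions, so that the two costs compared below are values of one formula,
    decreasing in [dot x y]. *)
Lemma coupled_collision_direction eu ev u v us vs :
  coupled_collision ((u, v), (us, vs))
    (direction eu (u - us), direction ev (v - vs)) = ((u, v), (us, vs)).
Proof.
rewrite /coupled_collision /post_collision /= -!scalerA !enorm_direction.
by congr ((_, _), (_, _)); apply/rowP => i; rewrite !mxE; field.
Qed.

Lemma post_collision_same u x : post_collision u u x = (u, u).
Proof.
rewrite /post_collision subrr (_ : enorm 0 = 0); last first.
  by apply/eqP; rewrite enorm_eq0.
rewrite mulr0 scale0r addr0 subr0.
by congr (_, _); apply/rowP => i; rewrite !mxE; field.
Qed.

Lemma coupled_collision_idle1 z n x : z.1.1 = z.2.1 ->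
  coupled_collision z n = coupled_collision z (x, n.2).
Proof. by move=> e; rewrite !coupled_collisionE -e !post_collision_same. Qed.

Lemma coupled_collision_idle2 z n x : z.1.2 = z.2.2 ->
  coupled_collision z n = coupled_collision z (n.1, x).
Proof. by move=> e; rewrite !coupled_collisionE -e !post_collision_same. Qed.

Lemma coupled_collision_idle z n : z.1 = z.2 -> coupled_collision z n = z.
Proof.
move=> e; rewrite coupled_collisionE -e !post_collision_same.
by case: z e => [[u v] _] /= <-.
Qed.

Definition pair_cost z : R :=
  enorm (z.1.1 - z.1.2) ^+ 2 + enorm (z.2.1 - z.2.2) ^+ 2.

Lemma pair_cost_collision u v us vs x y : sphere x -> sphere y ->
  pair_cost (coupled_collision ((u, v), (us, vs)) (x, y)) =
  2 * dot (2^-1 *: (u + us) - 2^-1 *: (v + vs))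
          (2^-1 *: (u + us) - 2^-1 *: (v + vs)) +
  2 * ((2^-1 * enorm (u - us)) ^+ 2 + (2^-1 * enorm (v - vs)) ^+ 2) -
  enorm (u - us) * enorm (v - vs) * dot x y.
Proof.
move=> /sphere_dot xx /sphere_dot yy.
rewrite /pair_cost /coupled_collision /post_collision /= !enorm_sqr.
set A := 2^-1 *: (u + us); set B := 2^-1 *: (v + vs).
set al := enorm (u - us); set be := enorm (v - vs).
pose w := (2^-1 * al) *: x - (2^-1 * be) *: y.
have -> : A + (2^-1 * al) *: x - (B + (2^-1 * be) *: y) = (A - B) + w.
  by apply/rowP => i; rewrite !mxE; ring.
have -> : A - (2^-1 * al) *: x - (B - (2^-1 * be) *: y) = (A - B) - w.
  by apply/rowP => i; rewrite !mxE; ring.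
rewrite dotDD (dotBB (A - B) w); have -> : dot w w =
    (2^-1 * al) ^+ 2 + (2^-1 * be) ^+ 2 - 2^-1 * al * be * dot x y.
  by rewrite /w dotBB !dotZl !dotZr xx yy; field.
by field.
Qed.

Lemma pair_cost_decreasing eu ev u v us vs x y :
  sphere eu -> sphere ev -> sphere x -> sphere y ->
  dot (direction eu (u - us)) (direction ev (v - vs)) <= dot x y ->
  pair_cost (coupled_collision ((u, v), (us, vs)) (x, y)) <=
  pair_cost ((u, v), (us, vs)).
Proof.
move=> seu sev sx sy xy.
rewrite -{2}(coupled_collision_direction eu ev u v us vs) !pair_cost_collision//.
- by rewrite lerD2l lerN2 ler_wpM2l// mulr_ge0// enorm_ge0.
- exact: sphere_direction.
- exact: sphere_direction.
Qed.

Lemma measurable_coupled_collision z : measurable_fun setT (coupled_collision z).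
Proof.
case: z => [[u v] [us vs]]; rewrite /coupled_collision /post_collision/=.
have m1 k (s : R) (h : E * E -> E) : measurable_fun setT h ->
    measurable_fun setT (fun w => k + s *: h w).
  by move=> mh; apply: measurable_rowD => //; exact: measurable_rowZ.
have m2 k (s : R) (h : E * E -> E) : measurable_fun setT h ->
    measurable_fun setT (fun w => k - s *: h w).
  by move=> mh; apply: measurable_rowB => //; exact: measurable_rowZ.
by apply: measurable_fun_pair; apply: measurable_fun_pair;
  [exact: m1|exact: m1|exact: m2|exact: m2].
Qed.

End collisions.

(* The coupled transition is a bare set function, to which extensionality of the
   integral with respect to a measure does not apply. *)
Lemma eq_integral_fun {R : realType} {d} {T : measurableType d}
    (mu : set T -> \bar R) (f g : T -> \bar R) :
  f =1 g -> (\int[mu]_x f x = \int[mu]_x g x)%E.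
Proof. by move=> /funext ->. Qed.

Section generator_symmetry.
Context {R : realType} {d : nat}.
Local Notation E := 'rV[R]_d.
Local Notation two_body := ((E * E) * (E * E))%type.
Variables (b : {finite_measure set R -> \bar R}).
Variables (c : R.-pker (R * E)%type ~> E) (hc : isotropic_transition c).
Variables (sigma : probability E R) (hsigma : uniform_on (@sphere R d) sigma).
Variables (eu ev : E) (heu : sphere eu) (hev : sphere ev).

Lemma measurable_isometry (g : E -> E) : euclid_isometry g ->
  measurable_fun setT g.
Proof.
move=> isog; have isof := euclid_isometry_linear isog.
have -> : g = (fun x => (g x - g 0) + g 0) by apply/funext => x; rewrite subrK.
by apply: measurable_rowD => //; exact: measurable_linear_isometry isof.
Qed.

Lemma coupled_generatorE (psi : two_body -> R) z :
  coupled_generator b c sigma eu ev psi z =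
  fine (\int[b]_(theta in `[0%R, pi])
    \int[coupled_transition c sigma theta (direction eu (z.1.1 - z.2.1))
                                          (direction ev (z.1.2 - z.2.2))]_n
      (psi (coupled_collision z n) - psi z)%:E)%E.
Proof. by case: z => [[u v] [us vs]]. Qed.

(** When one of the two relative velocities vanishes, its direction is the
    arbitrary vector [eu] or [ev], which [g] does not move along. The collision
    then depends on the other direction only, whose law is the isotropic one by
    the marginal formulas, so that the arbitrary choice disappears. *)
Lemma coupled_generator_isometry (g : E -> E) (psi : two_body -> R) z :
  euclid_isometry g -> bounded_measurable psi ->
  coupled_generator b c sigma eu ev psi (two_body_map g z) =
  coupled_generator b c sigma eu ev (psi \o two_body_map g) z.
Proof.
move=> isog bpsi; have isof := euclid_isometry_linear isog.
have mg := measurable_isometry isog.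
pose f x := g x - g 0; rewrite -/f in isof.
have f0 : f 0 = 0 by rewrite /f subrr.
case: z => [[u v] [us vs]]; set z : two_body := ((u, v), (us, vs)).
have bg : bounded_measurable (psi \o two_body_map g).
  apply: (bounded_measurable_comp bpsi).
  by apply: measurable_fun_pair; apply: measurable_fun_pair;
    apply: (measurableT_comp mg) => //; apply: measurableT_comp.
have bF (phi : two_body -> R) y : bounded_measurable phi ->
    bounded_measurable (fun n => phi (coupled_collision y n) - phi y).
  move=> bphi; apply: bounded_measurableB; last exact: bounded_measurable_cst.
  exact: (bounded_measurable_comp bphi (measurable_coupled_collision y)).
have b1 (F : E * E -> R) : bounded_measurable F ->
    bounded_measurable (fun x => F (x, 0)).
  by move=> bFF; apply: (bounded_measurable_comp bFF); exact: measurable_fun_pair.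
have b2 (F : E * E -> R) : bounded_measurable F ->
    bounded_measurable (fun y => F (0, y)).
  by move=> bFF; apply: (bounded_measurable_comp bFF); exact: measurable_fun_pair.
pose F n := psi (coupled_collision (two_body_map g z) n) - psi (two_body_map g z).
pose G n := psi (two_body_map g (coupled_collision z n)) - psi (two_body_map g z).
have bFF : bounded_measurable F by exact: bF.
have bGG : bounded_measurable G by exact: (bF (psi \o two_body_map g) z bg).
have FG x y : F (f x, f y) = G (x, y).
  by rewrite /F /G coupled_collision_isometry.
rewrite (coupled_generatorE psi) (coupled_generatorE (psi \o _)).
apply: (congr1 fine); apply: eq_integral => theta.
rewrite inE /= in_itv/= => ht.
set a := direction eu (u - us); set e := direction ev (v - vs).
set a' := direction eu (g u - g us); set e' := direction ev (g v - g vs).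
rewrite -[LHS]/(\int[coupled_transition c sigma theta a' e']_n (F n)%:E)%E.
rewrite -[RHS]/(\int[coupled_transition c sigma theta a e]_n (G n)%:E)%E.
have F1 n : u = us -> F n = F (0, n.2).
  by move=> uus; rewrite /F (coupled_collision_idle1 _ 0)//= uus.
have F2 n : v = vs -> F n = F (n.1, 0).
  by move=> vvs; rewrite /F (coupled_collision_idle2 _ 0)//= vvs.
have G1 n : u = us -> G n = G (0, n.2).
  by move=> uus; rewrite /G (coupled_collision_idle1 _ 0).
have G2 n : v = vs -> G n = G (n.1, 0).
  by move=> vvs; rewrite /G (coupled_collision_idle2 _ 0).
clearbody F G.
have sa : sphere a by exact: sphere_direction.
have se : sphere e by exact: sphere_direction.
have sa' : sphere a' by exact: sphere_direction.
have se' : sphere e' by exact: sphere_direction.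
have gB x y : g x - g y = f (x - y).
  by rewrite (linear_isometryB isof) /f opprB addrA subrK.
have [uus|uus] := eqVneq u us.
  under eq_integral_fun => n do rewrite F1//.
  under [RHS]eq_integral_fun => n do rewrite G1//.
  rewrite (coupled_marginal2 hc sigma ht sa' se' (b2 _ bFF)).
  rewrite (coupled_marginal2 hc sigma ht sa se (b2 _ bGG)).
  under [RHS]eq_integral => y _ do rewrite -FG f0.
  have [vvs|vvs] := eqVneq v vs.
    have -> : e' = e by rewrite /e' /e vvs !subrr.
    by apply: eq_integral => y _; rewrite F2// [in RHS]F2.
  have -> : e' = f e by rewrite /e' gB direction_isometry// subr_eq0.
  exact: (isotropic_mean_push hc isof ht se (b2 _ bFF)).
have a'E : a' = f a by rewrite /a' gB direction_isometry// subr_eq0.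
have [vvs|vvs] := eqVneq v vs.
  under eq_integral_fun => n do rewrite F2//.
  under [RHS]eq_integral_fun => n do rewrite G2//.
  rewrite (coupled_marginal1 c sigma _ _ _ (b1 _ bFF)).
  rewrite (coupled_marginal1 c sigma _ _ _ (b1 _ bGG)).
  under [RHS]eq_integral => x _ do rewrite -FG f0.
  rewrite a'E; exact: (isotropic_mean_push hc isof ht sa (b1 _ bFF)).
have e'E : e' = f e by rewrite /e' gB direction_isometry// subr_eq0.
rewrite a'E e'E (coupled_integral_push hc hsigma e isof ht sa bFF)//.
by apply: eq_integral_fun => n; rewrite FG -surjective_pairing.
Qed.

Lemma coupled_generator_idle (psi : two_body -> R) z : z.1 = z.2 ->
  coupled_generator b c sigma eu ev psi z = 0.
Proof.
move=> e; rewrite coupled_generatorE integral0_eq// => theta _.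
under eq_integral_fun => n do rewrite coupled_collision_idle// subrr.
rewrite (coupled_marginal1 c sigma _ _ _ (bounded_measurable_cst 0)).
exact: integral0_eq.
Qed.

Lemma coupled_generator_le0 (psi : two_body -> R) z :
  bounded_measurable psi ->
  (forall z', pair_cost z' <= pair_cost z -> psi z' <= psi z) ->
  coupled_generator b c sigma eu ev psi z <= 0.
Proof.
case: z => [[u v] [us vs]]; set z : two_body := ((u, v), (us, vs)).
move=> bpsi psi_le; rewrite coupled_generatorE; apply: fine_le0.
pose J theta := (\int[coupled_transition c sigma theta
  (direction eu (u - us)) (direction ev (v - vs))]_n
    (psi (coupled_collision z n) - psi z)%:E)%E.
rewrite -[X in (X <= 0)%E]/(\int[b]_(theta in `[0%R, pi]) J theta)%E.
have J0 theta : 0 <= theta <= pi -> (J theta <= 0)%E.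
  move=> ht; apply: (coupled_integral_le0 hc sigma ht).
  - exact: sphere_direction.
  - exact: sphere_direction.
  - apply: bounded_measurableB; last exact: bounded_measurable_cst.
    exact: (bounded_measurable_comp bpsi (measurable_coupled_collision z)).
  - move=> x y sx sy xy; rewrite subr_le0; apply: psi_le.
    exact: pair_cost_decreasing xy.
rewrite (eq_integral (fun theta => - - J theta)%E) => [|theta _]; last first.
  by rewrite oppeK.
have NJ0 theta : `[0%R, pi]%classic theta -> (0 <= - J theta)%E.
  by rewrite /= in_itv/= oppe_ge0 => /J0.
by rewrite integral_ge0N// oppe_le0; exact: integral_ge0.
Qed.

End generator_symmetry.

(** * The particle system *)

Section particle_system.
Context {R : realType} {d N : nat}.
Local Notation E := 'rV[R]_d.
Local Notation two_body := ((E * E) * (E * E))%type.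
Local Notation state := (N.-tuple (E * E)).
Implicit Types (x y : state) (z : two_body).

Lemma measurable_set_pair x (n m : 'I_N) : measurable_fun setT (set_pair x n m).
Proof.
apply/measurable_fun_tnthP => i /=.
rewrite (_ : _ \o _ = fun z : two_body =>
  if i == n then z.1 else if i == m then z.2 else tnth x i); last first.
  by apply/funext => z /=; rewrite tnth_mktuple.
case: (i == n); first exact: measurable_fst.
by case: (i == m); [exact: measurable_snd|exact: measurable_cst].
Qed.

Lemma measurable_isometry_action (g : E -> E) : euclid_isometry g ->
  measurable_fun setT (isometry_action g : state -> state).
Proof.
move=> isog; have mg := measurable_isometry isog.
apply/measurable_fun_tnthP => i /=.
rewrite (_ : _ \o _ = (fun uv => (g uv.1, g uv.2)) \o (fun x => tnth x i)); last first.
  by apply/funext => x /=; rewrite tnth_map.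
apply: measurableT_comp; last exact: measurable_tnth.
by apply: measurable_fun_pair; apply: (measurableT_comp mg).
Qed.

Lemma measurable_coupling_cost : measurable_fun setT (@coupling_cost R d N).
Proof.
apply: measurable_funM => //; apply: measurable_sum => i.
apply: measurable_funX; apply: measurable_enorm; apply: measurable_rowB;
  by apply: measurableT_comp => //; exact: measurable_tnth.
Qed.

Lemma isometry_action_set_pair (g : E -> E) x n m z :
  isometry_action g (set_pair x n m z) =
  set_pair (isometry_action g x) n m (two_body_map g z).
Proof.
apply: eq_from_tnth => i; rewrite tnth_map !tnth_mktuple.
by case: (i == n) => //; case: (i == m) => //; rewrite tnth_map.
Qed.

Lemma coupling_cost_set_pair x n m z z' : n != m ->
  pair_cost z' <= pair_cost z ->
  coupling_cost (set_pair x n m z') <= coupling_cost (set_pair x n m z).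
Proof.
move=> nm zz'; rewrite /coupling_cost ler_wpM2l ?invr_ge0//.
have E (y : two_body) : \sum_(i < N) enorm ((tnth (set_pair x n m y) i).1 -
      (tnth (set_pair x n m y) i).2) ^+ 2 = pair_cost y +
    \sum_(i < N | (i != n) && (i != m)) enorm ((tnth x i).1 - (tnth x i).2) ^+ 2.
  rewrite (bigD1 n)//= (bigD1 m)//=; last by rewrite eq_sym.
  rewrite addrA; congr (_ + _).
    by rewrite /pair_cost !tnth_mktuple eqxx eq_sym (negbTE nm) eqxx.
  by apply: eq_bigr => i /andP[/negbTE ni /negbTE mi]; rewrite tnth_mktuple ni mi.
by rewrite !E lerD2r.
Qed.

Variables (b : {finite_measure set R -> \bar R}).
Variables (c : R.-pker (R * E)%type ~> E) (hc : isotropic_transition c).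
Variables (sigma : probability E R) (hsigma : uniform_on (@sphere R d) sigma).
Variables (eu ev : E) (heu : sphere eu) (hev : sphere ev).

Lemma nanbu_generator_isometry (g : E -> E) (psi : state -> R) :
  euclid_isometry g -> bounded_measurable psi ->
  nanbu_generator b c sigma eu ev (psi \o isometry_action g) =
  nanbu_generator b c sigma eu ev psi \o isometry_action g.
Proof.
move=> isog bpsi; apply/funext => x.
rewrite -[RHS]/(nanbu_generator b c sigma eu ev psi (isometry_action g x)).
rewrite /nanbu_generator; congr (N%:R^-1 * _).
apply: eq_bigr => n _; apply: eq_bigr => m _.
have -> : (tnth (isometry_action g x) n, tnth (isometry_action g x) m) =
    two_body_map g (tnth x n, tnth x m) by rewrite !tnth_map.
rewrite (coupled_generator_isometry b hc hsigma heu hev _ isog); last first.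
  exact: (bounded_measurable_comp bpsi (measurable_set_pair _ _ _)).
congr (coupled_generator _ _ _ _ _ _ _).
by apply/funext => z /=; rewrite isometry_action_set_pair.
Qed.

Definition costlier (r : R) : set state := [set x | r < coupling_cost x].

Lemma measurable_costlier r : measurable (costlier r).
Proof.
rewrite (_ : costlier r = @coupling_cost R d N @^-1` `]r, +oo[%classic).
  by rewrite -[X in measurable X]setTI; exact: measurable_coupling_cost.
by apply/seteqP; split => x; rewrite /= in_itv/= andbT.
Qed.

(** The indicator of a superlevel set of the cost can only decrease along a
    collision. A particle colliding with itself is treated apart, because
    [set_pair x n n] forgets the second component of the pair. *)
Lemma nanbu_generator_costlier r x :
  nanbu_generator b c sigma eu ev (\1_(costlier r)) x <= 0.
Proof.
rewrite /nanbu_generator mulr_ge0_le0 ?invr_ge0//.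
apply: sumr_le0 => n _; apply: sumr_le0 => m _.
have [->|nm] := eqVneq n m; first by rewrite (coupled_generator_idle b c sigma).
apply: (coupled_generator_le0 b hc sigma heu hev).
  apply: (bounded_measurable_comp _ (measurable_set_pair _ _ _)).
  by apply: bounded_measurable_indic; exact: measurable_costlier.
move=> z' zz'; have := coupling_cost_set_pair x nm zz'.
rewrite !indicE ler_nat; case: (boolP (set_pair x n m z' \in _)) => //.
rewrite inE /costlier /= => rz' z'z; rewrite mem_set//=.
exact: lt_le_trans z'z.
Qed.

End particle_system.

(** * Almost sure decrease of the cost *)

Section monotone_coupling.
Context {R : realType} {dS} {S : measurableType dS}.
Context {dO} {Omega : measurableType dO}.
Variables (Pr : probability Omega R) (X : R -> Omega -> S).
Variables (C : S -> R) (L : (S -> R) -> S -> R).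
Hypothesis mC : measurable_fun setT C.
Hypothesis L_le0 : forall r x, L (\1_[set x | r < C x]) x <= 0.

Let measurable_superlevel r : measurable [set x | r < C x].
Proof.
rewrite (_ : [set x | _] = C @^-1` `]r, +oo[%classic).
  by rewrite -[X in measurable X]setTI; exact: mC.
by apply/seteqP; split => x; rewrite /= in_itv/= andbT.
Qed.

Let measurable_sublevel r : measurable [set x | C x <= r].
Proof.
rewrite (_ : [set x | _] = ~` [set x | r < C x]).
  exact/measurableC/measurable_superlevel.
by apply/seteqP; split => x /=; [rewrite leNgt => /negP|move/negP; rewrite -leNgt].
Qed.

Lemma transition_superlevel (P : R -> R.-pker S ~> S) t r x :
  markov_semigroup P -> has_generator P L -> 0 <= t -> C x <= r ->
  P t x [set y | r < C y] = 0%E.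
Proof.
move=> semiP genP t0 xr; have mB := measurable_superlevel r.
have := transition_supermedian semiP genP x t0 (bounded_measurable_indic mB) (L_le0 r).
rewrite indicE memNset/=; last by apply/negP; rewrite -leNgt.
rewrite /transition /Rintegral integral_indic// setIT => Ple0.
have Pfin : P t x [set y | r < C y] \is a fin_num.
  have PT : P t x setT = 1%E by exact: prob_kernel.
  rewrite ge0_fin_numE// (@le_lt_trans _ _ (P t x setT))//.
    by apply: le_measure; rewrite ?inE.
  by rewrite PT ltry.
rewrite -(fineK Pfin); congr EFin; apply/eqP; rewrite eq_le Ple0 /=.
by rewrite fine_ge0.
Qed.

Hypothesis LX : markov_jump_process Pr X L.

(* Up-crossing a fixed level between two fixed times has probability zero. *)
Let crossing s t r : 0 <= s -> 0 <= t ->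
  {ae Pr, forall w, C (X s w) <= r -> C (X (s + t) w) <= r}.
Proof.
move=> s0 t0; have [mX _ [P [semiP genP XP]]] := LX.
exists (X s @^-1` [set x | C x <= r] `&` X (s + t) @^-1` [set x | r < C x]); split.
- apply: measurableI; rewrite -[X in measurable X]setTI.
    exact: mX.
  by apply: mX => //; exact: addr_ge0.
- rewrite XP//; last by apply: past_preimage => //; exact: measurable_sublevel.
  by rewrite integral0_eq// => w /= wr; exact: transition_superlevel.
move=> w /= /not_implyP[wr /negP]; rewrite -ltNge => rw; split => //.
Qed.

Lemma jump_path_interval (f : R -> S) t : jump_path f -> 0 <= t ->
  exists2 e : R, 0 < e & forall t', t <= t' < t + e -> f t' = f t.
Proof.
move=> [tau [tau0 tau_le tau_oo ftau]] t0.
have [n tn] : exists n, t < tau n.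
  have [n _ /(_ n (leqnn n)) /= tn] := cvgry_gt tau_oo t.
  by exists n.
have [k tk kt] : exists2 k, tau k <= t & t < tau k.+1.
  elim: n tn => [|n IH tn]; first by rewrite tau0 ltNge t0.
  by have [tt|/IH//] := leP (tau n) t; exists n.
exists (tau k.+1 - t); first by rewrite subr_gt0.
move=> t' /andP[tt']; rewrite addrC subrK => t'k.
rewrite (ftau k t'); last by rewrite (le_trans tk)//= t'k.
by rewrite (ftau k t)// tk kt.
Qed.

(** Almost surely no rational level is crossed upwards between two rational
    times. Along a right-continuous path this extends to all times, by moving
    each of the two times slightly to the right without crossing a jump. *)
Lemma cost_decreasing : {ae Pr, forall w, forall t h : R, 0 <= t -> 0 <= h ->
  C (X (t + h) w) <= C (X t w)}.
Proof.
have [_ Xjump _] := LX.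
have : {ae Pr, forall w, forall k : nat, forall s t r : rat,
    unpickle k = Some (s, t, r) -> 0 <= s -> 0 <= t ->
    C (X (ratr s) w) <= ratr r -> C (X (ratr s + ratr t) w) <= ratr r}.
  apply/ae_foralln => k; case: (@unpickle (rat * rat * rat)%type k) => [[[s t] r]|].
    have [s0|s0] := leP 0 s; last first.
      by apply: aeW => w ? ? ? [<- _ _] /le_lt_trans/(_ s0); rewrite ltxx.
    have [t0|t0] := leP 0 t; last first.
      by apply: aeW => w ? ? ? [_ <- _] _ /le_lt_trans/(_ t0); rewrite ltxx.
    have := @crossing (ratr s) (ratr t) (ratr r).
    rewrite !ler0q => /(_ s0 t0); apply: filterS => w H s' t' r' [<- <- <-] _ _.
    exact: H.
  by apply: aeW.
apply: filterS2 Xjump => w jumpw H t h t0 h0.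
move: h0; rewrite le_eqVlt => /predU1P[<-|h0]; first by rewrite addr0.
have [e1 e10 f1] := jump_path_interval jumpw t0.
have th0 : 0 <= t + h by rewrite addr_ge0// ltW.
have [e2 e20 f2] := jump_path_interval jumpw th0.
have : t < t + Num.min e1 h by rewrite ltrDl lt_min e10.
move=> /rat_in_itvoo[s]; rewrite in_itv/= => /andP[ts sth].
have : t + h < t + h + e2 by rewrite ltrDl.
move=> /rat_in_itvoo[s']; rewrite in_itv/= => /andP[ths' s'th].
have <- : X (ratr s) w = X t w.
  by apply: f1; rewrite ltW//= (lt_le_trans sth)// lerD2l ge_min lexx.
have <- : X (ratr s') w = X (t + h) w by apply: f2; rewrite ltW.
have ss' : s <= s'.
  rewrite -(ler_rat R) (le_trans (ltW sth))// (le_trans _ (ltW ths'))//.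
  by rewrite lerD2l ge_min lexx orbT.
have s0 : 0 <= s by rewrite -(ler0q R) (le_trans t0)// ltW.
rewrite leNgt; apply/negP => /rat_in_itvoo[r]; rewrite in_itv/= => /andP[sr rs'].
have := H (pickle (s, s' - s, r)) s (s' - s) r.
rewrite pickleK subr_ge0 -rmorphD/= [s + _]addrC subrK => /(_ erefl s0 ss' (ltW sr)).
by rewrite leNgt rs'.
Qed.

End monotone_coupling.

(** * Invariance and monotonicity *)

Theorem lemma4p7 (R : realType) (d N : nat) (hd : (3 <= d)%N) (hN : (1 <= N)%N)
    (b : {finite_measure set R -> \bar R})
    (c : R.-pker (R * 'rV[R]_d)%type ~> 'rV[R]_d)
    (hc : isotropic_transition c)
    (sigma : probability 'rV[R]_d R)
    (hsigma : uniform_on (@sphere R d) sigma)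
    (eu ev : 'rV[R]_d) (heu : sphere eu) (hev : sphere ev) :
  (forall g : 'rV[R]_d -> 'rV[R]_d, euclid_isometry g ->
     forall (d1 : measure_display) (O1 : measurableType d1)
       (P1 : probability O1 R) (X1 : R -> O1 -> N.-tuple ('rV[R]_d * 'rV[R]_d))
       (d2 : measure_display) (O2 : measurableType d2)
       (P2 : probability O2 R) (X2 : R -> O2 -> N.-tuple ('rV[R]_d * 'rV[R]_d))
       (x : N.-tuple ('rV[R]_d * 'rV[R]_d)),
     coupled_nanbu_system b c sigma eu ev P1 X1 -> started_from P1 X1 x ->
     coupled_nanbu_system b c sigma eu ev P2 X2 ->
     started_from P2 X2 (isometry_action g x) ->
     same_law P1 (fun t w => isometry_action g (X1 t w)) P2 X2) /\
  (forall (dO : measure_display) (Omega : measurableType dO)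
     (P : probability Omega R)
     (X : R -> Omega -> N.-tuple ('rV[R]_d * 'rV[R]_d)),
   coupled_nanbu_system b c sigma eu ev P X ->
   {ae P, forall w, forall t h : R, 0 <= t -> 0 <= h ->
     coupling_cost (X (t + h) w) <= coupling_cost (X t w)}).
Proof.
split=> [g isog d1 O1 P1 X1 d2 O2 P2 X2 x|dO Omega P X sysX]; last first.
  apply: cost_decreasing sysX; first exact: measurable_coupling_cost.
  by move=> r y; exact: (nanbu_generator_costlier b hc sigma heu hev).
move=> [mX1 _ [T1 [semi1 gen1 XT1]]] X1x [mX2 _ [T2 [semi2 gen2 XT2]]] X2gx.
have mg : measurable_fun setT (isometry_action g : N.-tuple _ -> _).
  exact: measurable_isometry_action.
have T12 t psi y : 0 <= t -> bounded_measurable psi ->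
    transition T1 t (psi \o isometry_action g) y =
    transition T2 t psi (isometry_action g y).
  apply: (transition_intertwine semi1 gen1 semi2 gen2 mg) => phi bphi.
  exact: nanbu_generator_isometry.
apply: same_law_cylinder => // [t t0|ts A ts0 mA].
  exact: measurableT_comp mg (mX1 t t0).
rewrite (started_cylinder mX2 XT2 X2gx)// -(visits_intertwine T12)//.
have mgA t : measurable (isometry_action g @^-1` A t).
  by rewrite -[X in measurable X]setTI; exact: mg.
by rewrite -(started_cylinder mX1 XT1 X1x).
Qed.
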